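(* For every integer $d\ge1$ there is a constant $C_d$ depending only on $d$ such that the following holds. Let $n_1,\dots,n_d\ge 1$ be integers, $n=n_1\cdots n_d$, let $\mathbf x_1,\dots,\mathbf x_n$ be an enumeration of the lattice design $\mathbb L_{n_1,\dots,n_d}$, let $\sigma>0$, let $f^*:[0,1]^d\to\mathbb R$, and let $y_i=f^*(\mathbf x_i)+\xi_i$ with $\xi_1,\dots,\xi_n$ i.i.d. $N(0,\sigma^2)$. If the tuning parameter $V>0$ satisfies $V\ge V^*:=V_{\mathrm{HK}\mathbf 0}(f^*;[0,1]^d)$, then the estimator $$\hat f_{\mathrm{HK}\mathbf 0,V}\in\operatorname*{arg\,min}_{f:\,V_{\mathrm{HK}\mathbf 0}(f)\le V}\frac1n\sum_{i=1}^n (y_i-f(\mathbf x_i))^2$$ satisfies $$\mathcal R(\hat f_{\mathrm{HK}\mathbf 0,V},f^* )\le C_d\left(\frac{\sigma^2V}{n}\right)^{2/3}\left(\log\left(2+\frac{V\sqrt n}{\sigma}\right)\right)^{\frac{2d-1}{3}}+C_d\frac{\sigma^2}{n}.$$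
   Context: Notation: $\mathbf 0=(0,\dots,0)$; $\mathbf a\preceq\mathbf b$ means $a_j\le b_j$ for all $j$; for $\mathbf a\preceq\mathbf b$, $[\mathbf a,\mathbf b]=\prod_j[a_j,b_j]$. Quasi-volume: for $f:[0,1]^d\to\mathbb R$ and distinct $\mathbf a\preceq\mathbf b$ in $[0,1]^d$, $$\Delta(f;[\mathbf a,\mathbf b])=\sum_{j_1=0}^{J_1}\cdots\sum_{j_d=0}^{J_d}(-1)^{j_1+\dots+j_d}f(b_1+j_1(a_1-b_1),\dots,b_d+j_d(a_d-b_d)),$$ where $J_i=1$ if $a_i\ne b_i$ and $J_i=0$ otherwise. Vitali variation: given univariate partitions $0=x^{(s)}_0<\dots<x^{(s)}_{k_s}=1$, $s=1,\dots,d$, the split they generate is the collection $\mathcal P$ of all rectangles $\prod_{s=1}^d[x^{(s)}_{l_s},x^{(s)}_{l_s+1}]$, $0\le l_s\le k_s-1$. Set $V^{(d)}(f;[0,1]^d)=\sup_{\mathcal P}\sum_{A\in\mathcal P}|\Delta(f;A)|$, supremum over all such splits. HK$\mathbf 0$ variation: for nonempty $S\subseteq\{1,\dots,d\}$ let $f_S:[0,1]^{|S|}\to\mathbb R$ be the restriction of $f$ to $\{\mathbf u\in[0,1]^d:u_j=0\ \forall j\notin S\}$, viewed as a function of the coordinates in $S$. Then $V_{\mathrm{HK}\mathbf 0}(f)=V_{\mathrm{HK}\mathbf 0}(f;[0,1]^d)=\sum_{\varnothing\ne S\subseteq\{1,\dots,d\}}V^{(|S|)}(f_S;[0,1]^{|S|})$.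 Lattice design: $\mathbb L_{n_1,\dots,n_d}=\{(i_1/n_1,\dots,i_d/n_d):0\le i_j\le n_j-1,\ j=1,\dots,d\}$. Loss and risk: $\mathcal L(\hat f,f^* )=\frac1n\sum_{i=1}^n(\hat f(\mathbf x_i)-f^*(\mathbf x_i))^2$ and $\mathcal R(\hat f,f^* )=\mathbb E\,\mathcal L(\hat f,f^* )$. The minimization defining the estimator is over all $f:[0,1]^d\to\mathbb R$ with $V_{\mathrm{HK}\mathbf 0}(f)\le V$; the values of the minimizer at the design points do not depend on the choice of minimizer. *)

(* Defs.v *)
From HB Require Import structures.
From mathcomp Require Import all_boot all_order all_algebra.
From mathcomp Require Import all_classical all_reals all_analysis.
Set Implicit Arguments.
Unset Strict Implicit.
Unset Printing Implicit Defensive.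
Import Order.TTheory GRing.Theory Num.Theory.
Import numFieldNormedType.Exports.
Local Open Scope classical_set_scope.
Local Open Scope ring_scope.

(* A function [0,1]^d -> R is represented by a total function 'rV[R]_d -> R;
   everything below evaluates it at points of the cube only. *)

(* Coordinate i of j ranges over {0, J_i}, with J_i = 1 if a_i != b_i and
   J_i = 0 otherwise. *)
Definition quasi_volume (R : realType) (d : nat) (f : 'rV[R]_d -> R)
    (a b : 'rV[R]_d) : R :=
  \sum_(j : {ffun 'I_d -> 'I_2}
        | [forall i, (j i <= (a 0 i != b 0 i)%R)%N])
    (-1) ^+ (\sum_(i < d) j i)%N *
    f (\row_(i < d) (b 0 i + (j i)%:R * (a 0 i - b 0 i))).

(* x s is the list of points of the s-th univariate partition without its
   initial point 0, as in itv_partition; its number of intervals is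
   k_s = size (x s). *)
Definition partition_point (R : realType) (d : nat) (x : 'I_d -> seq R)
    (l : 'I_d -> nat) : 'rV[R]_d :=
  \row_(s < d) nth 0 (0 :: x s) (l s).

Definition split_variation (R : realType) (d : nat) (f : 'rV[R]_d -> R)
    (x : 'I_d -> seq R) : R :=
  \sum_(l : {dffun forall s : 'I_d, 'I_(size (x s))})
    `|quasi_volume f (partition_point x (fun s => l s))
                     (partition_point x (fun s => (l s).+1))|.

Definition vitali_variation (R : realType) (d : nat) (f : 'rV[R]_d -> R) :
    \bar R :=
  ereal_sup [set (split_variation f x)%:E
            | x in [set x : 'I_d -> seq R |
                     forall s, itv_partition 0 1 (x s)]].

(* The k-th variable of f_S is the coordinate enum_val k of S, and the inner
   sum has at most one term: it is that variable if j \in S, and 0 if not. *)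
Definition face_restriction (R : realType) (d : nat) (f : 'rV[R]_d -> R)
    (S : {set 'I_d}) : 'rV[R]_#|S| -> R :=
  fun u => f (\row_(j < d) \sum_(k < #|S| | enum_val k == j) u 0 k).

Definition hk0_variation (R : realType) (d : nat) (f : 'rV[R]_d -> R) :
    \bar R :=
  (\sum_(S : {set 'I_d} | S != finset.set0)
     vitali_variation (@face_restriction R d f S))%E.

Definition lattice_design (R : realType) (d : nat) (m : 'I_d -> nat) :
    set 'rV[R]_d :=
  [set p | exists i : 'I_d -> nat,
     (forall j, (i j < m j)%N) /\ p = \row_(j < d) ((i j)%:R / (m j)%:R)].

Definition residual (R : realType) (d n : nat) (x : 'I_n -> 'rV[R]_d)
    (y : 'I_n -> R) (f : 'rV[R]_d -> R) : R :=
  n%:R^-1 * \sum_(i < n) (y i - f (x i)) ^+ 2.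

Definition is_hk0_lse (R : realType) (d n : nat) (x : 'I_n -> 'rV[R]_d)
    (y : 'I_n -> R) (V : R) (f : 'rV[R]_d -> R) : Prop :=
  (hk0_variation f <= V%:E)%E /\
  forall g : 'rV[R]_d -> R, (hk0_variation g <= V%:E)%E ->
    residual x y f <= residual x y g.

Definition loss (R : realType) (d n : nat) (x : 'I_n -> 'rV[R]_d)
    (g f : 'rV[R]_d -> R) : R :=
  n%:R^-1 * \sum_(i < n) (g (x i) - f (x i)) ^+ 2.

Definition risk (R : realType) (d n : nat) (x : 'I_n -> 'rV[R]_d)
    (disp : measure_display) (T : measurableType disp) (P : probability T R)
    (g : T -> 'rV[R]_d -> R) (f : 'rV[R]_d -> R) : \bar R :=
  'E_P[fun w => loss x (g w) f].

Definition mutually_independent (R : realType) (n : nat)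
    (disp : measure_display) (T : measurableType disp) (P : probability T R)
    (X : 'I_n -> {RV P >-> R}) : Prop :=
  forall (I : {set 'I_n}) (A : 'I_n -> set R),
    (forall i, measurable (A i)) ->
    P [set w | forall i, i \in I -> A i (X i w)] =
    (\prod_(i in I) P (X i @^-1` A i))%E.

Definition iid_normal (R : realType) (n : nat)
    (disp : measure_display) (T : measurableType disp) (P : probability T R)
    (sigma : R) (X : 'I_n -> {RV P >-> R}) : Prop :=
  mutually_independent X /\
  forall (i : 'I_n) (A : set R), measurable A ->
    distribution P (X i) A = normal_prob 0 sigma A.

(* Main.v *)
(* Expanding the lattice values of f in the indicators 1[k <= .] of the lattice
   orthants, with the mixed differences of f as coefficients, bounds by
   V_HK0(f) the l1 norm of the coefficients with k <> 0.  The error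
   fhat - fstar is therefore a combination of orthants with l1 norm at most 2V,
   and optimality of fhat bounds its squared norm by twice its inner product
   with the noise.  A tensor Haar-type orthogonal decomposition splits this
   inner product by total dyadic level.

   Levels up to J span a space of dimension at most (J+1)^(d-1) 2^(J+1), the
   hyperbolic cross; Cauchy-Schwarz bounds their contribution by the squared
   norm of the projected noise.  On level s > J an orthant has squared norm at
   most 4^d n (s+1)^(d-1) 2^(-s) and is a convex combination of the level-s
   parts of orthants cornered on a dyadic grid of at most 2^((s+1)d) points, so
   a Gaussian maximum over the grid costs only a factor of order sqrt(s+1): no
   metric entropy is needed and no logarithm of n appears.  Choosing J to balance
   (J+1)^(d-1) 2^J against T (J+1)^(d/2) 2^(-J/2), where T = V sqrt(n) / sigma,
   gives the rate. *)
Require Import Defs.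
From HB Require Import structures.
From mathcomp Require Import all_boot all_order all_algebra.
From mathcomp Require Import all_classical all_reals all_analysis.
From mathcomp Require Import measurable_realfun.
From mathcomp Require Import ring lra zify.
Set Implicit Arguments.
Unset Strict Implicit.
Unset Printing Implicit Defensive.
Import Order.TTheory GRing.Theory Num.Theory.
Import numFieldNormedType.Exports.
Local Open Scope classical_set_scope.
Local Open Scope ring_scope.

(** * Dyadic averages and Haar projections on an interval *)

Section Averaging.
Variables (R : realFieldType) (m N : nat).
Hypothesis mN : (m <= N)%N.

Definition block_size (r a : nat) : nat :=
  \sum_(b < m) (b %/ 2 ^ r == a %/ 2 ^ r)%N.

(** Kernel of conditional expectation on the dyadic blocks of length [2 ^ r], the last one cut at
    [m]. Sums run over ['I_N], with zeros beyond [m], so that axes of different lengths can share an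
    index type. *)
Definition block_avg (r a b : nat) : R :=
  [&& (a < m)%N, (b < m)%N & (a %/ 2 ^ r == b %/ 2 ^ r)%N]%:R
    / (block_size r a)%:R.

Lemma block_size_gt0 r a : (a < m)%N -> (0 < block_size r a)%N.
Proof.
by move=> am; rewrite /block_size (bigD1 (Ordinal am)) //= eqxx.
Qed.

Lemma eq_block_size r a b :
  (a %/ 2 ^ r = b %/ 2 ^ r)%N -> block_size r a = block_size r b.
Proof. by rewrite /block_size => ->. Qed.

Lemma block_size_le r a : (block_size r a <= 2 ^ r)%N.
Proof.
clear mN; rewrite /block_size; set q := (a %/ 2 ^ r)%N.
have -> : (\sum_(b < m) (b %/ 2 ^ r == q) = \sum_(0 <= b < m | b %/ 2 ^ r == q) 1)%N.
  by rewrite big_mkord [RHS]big_mkcond; apply: eq_bigr => b _; case: eqP.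
have sub : (\sum_(0 <= b < m | b %/ 2 ^ r == q) 1
    <= \sum_(q * 2 ^ r <= b < q * 2 ^ r + 2 ^ r) 1)%N.
  rewrite sum1_count sum1_size -size_filter; apply: uniq_leq_size.
    by rewrite filter_uniq // iota_uniq.
  move=> b; rewrite mem_filter !mem_iota => /andP[/eqP qE _].
  have := divn_eq b (2 ^ r); have := ltn_pmod b (expn_gt0 2 r); rewrite qE.
  lia.
by apply: leq_trans sub _; rewrite sum1_size size_iota addKn.
Qed.

Lemma block_avg_sym r a b : block_avg r a b = block_avg r b a.
Proof.
rewrite /block_avg; case: (ltnP a m); case: (ltnP b m) => //= _ _; rewrite ?mul0r //.
by rewrite eq_sym; case: eqP => [/eq_block_size -> //|]; rewrite !mul0r.
Qed.

Lemma block_avg_ge0 r a b : 0 <= block_avg r a b.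
Proof. by rewrite /block_avg divr_ge0. Qed.

Lemma sum_block_avg r a : \sum_(b < N) block_avg r a b = (a < m)%:R.
Proof.
rewrite /block_avg -big_distrl /=; case: (ltnP a m) => [am|_] /=; last first.
  by rewrite big1 ?mul0r.
rewrite (eq_bigr (fun b : 'I_N => if (b < m)%N then (b %/ 2 ^ r == a %/ 2 ^ r)%N%:R else 0)).
  rewrite -big_mkcond /= -(big_ord_widen N (fun b => (b %/ 2 ^ r == a %/ 2 ^ r)%N%:R)) //.
  by rewrite -natr_sum divff // pnatr_eq0 -lt0n block_size_gt0.
by move=> b _; case: ifP; rewrite //= eq_sym.
Qed.

(** Tower property: [block_avg s] is constant on the finer blocks, and the rows of [block_avg r]
    indexed below [m] sum to 1. *)
Lemma block_avg_comp r s a c : (r <= s)%N ->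
  \sum_(b < N) block_avg r a b * block_avg s b c = block_avg s a c.
Proof.
move=> rs; rewrite (eq_bigr (fun b : 'I_N => block_avg r a b * block_avg s a c)).
  rewrite -big_distrl /= sum_block_avg; case: ltnP => am; rewrite ?mul1r //.
  by rewrite mul0r /block_avg ltnNge am mul0r.
move=> b _; rewrite {1 3}/block_avg; case: andP => [[am /andP[bm /eqP ab]]|_]; last by rewrite !mul0r.
congr (_ * _).
have abs : (a %/ 2 ^ s = b %/ 2 ^ s)%N.
  by rewrite -(subnKC rs) expnD !divnMA ab.
by rewrite /block_avg am bm /= abs (eq_block_size abs).
Qed.

Lemma block_avg_comp_fine r s a c : (r <= s)%N ->
  \sum_(b < N) block_avg s a b * block_avg r b c = block_avg s a c.
Proof.
move=> rs; rewrite block_avg_sym -(block_avg_comp c a rs).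
by apply: eq_bigr => b _; rewrite mulrC [in LHS]block_avg_sym [X in _ * X]block_avg_sym.
Qed.

Lemma block_avg0 a b : block_avg 0 a b = ((a < m)%N && (a == b))%:R.
Proof.
rewrite /block_avg expn0 !divn1; case: (ltnP a m) => am /=; last by rewrite mul0r.
case: eqP => [<-|_]; rewrite ?andbF ?mul0r //; rewrite am /=.
suff -> : block_size 0 a = 1%N by rewrite divr1.
rewrite /block_size (bigD1 (Ordinal am)) //= eqxx big1 // => i /negPf.
by rewrite -val_eqE /= expn0 !divn1 => ->.
Qed.

(** Each nonempty block contributes exactly 1 to the trace, its size times the inverse of its
    size. *)
Lemma block_avg_trace r K : (m <= K * 2 ^ r)%N ->
  \sum_(a < N) block_avg r a a <= K%:R.
Proof.
move=> mK.
have -> : \sum_(a < N) block_avg r a a = \sum_(a < m) (block_size r a)%:R^-1.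
  rewrite (big_ord_widen N (fun a => (block_size r a)%:R^-1 : R)) // [RHS]big_mkcond /=.
  by apply: eq_bigr => a _; rewrite /block_avg eqxx andbT andbb; case: ifP; rewrite ?mul1r ?mul0r.
have lt a : (a < m -> a %/ 2 ^ r < K)%N.
  by move=> am; rewrite ltn_divLR ?expn_gt0 // (leq_trans am).
rewrite (eq_bigr (fun a : 'I_m =>
  \sum_(k < K) (a %/ 2 ^ r == k)%N%:R / (block_size r a)%:R)); last first.
  move=> a _; rewrite (bigD1 (Ordinal (lt _ (ltn_ord a)))) //= eqxx mul1r big1 ?addr0 // => k /negPf.
  by rewrite -val_eqE /= eq_sym => ->; rewrite mul0r.
rewrite exchange_big /= -[K in K%:R]card_ord -sum1_card natr_sum; apply: ler_sum => k _.
case: (pickP (fun a : 'I_m => a %/ 2 ^ r == k)%N) => [a /eqP ak|none]; last first.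
  by rewrite big1 // => a _; rewrite none mul0r.
rewrite (eq_bigr (fun b : 'I_m => (b %/ 2 ^ r == a %/ 2 ^ r)%N%:R / (block_size r a)%:R)).
  by rewrite -big_distrl /= -natr_sum divff // pnatr_eq0 -lt0n block_size_gt0.
move=> b _; rewrite -ak; case: eqP => [/eq_block_size -> //|]; by rewrite !mul0r.
Qed.

Definition step (x a : nat) : R := (x <= a)%N%:R.

Definition avg_step (r x a : nat) : R := \sum_(b < N) block_avg r a b * step x b.

Lemma avg_step_out r x a : (a %/ 2 ^ r != x %/ 2 ^ r)%N ->
  avg_step r x a = ((a < m) && (x %/ 2 ^ r <= a %/ 2 ^ r))%N%:R.
Proof.
move=> ax.
rewrite /avg_step (eq_bigr (fun b : 'I_N => block_avg r a b * (x %/ 2 ^ r <= a %/ 2 ^ r)%N%:R)).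
  by rewrite -big_distrl /= sum_block_avg -natrM mulnb.
move=> b _; rewrite /block_avg; case: andP => [[am /andP[bm /eqP ab]]|_]; last by rewrite !mul0r.
congr (_ * _); rewrite /step; congr (_ %:R); congr (nat_of_bool _).
have le c e : (c <= e -> c %/ 2 ^ r <= e %/ 2 ^ r)%N by exact: leq_div2r.
have := le x b; have := le b x; move: ax; rewrite ab; lia.
Qed.

Lemma avg_step_start r k a :
  avg_step r (k * 2 ^ r) a = ((a < m) && (k <= a %/ 2 ^ r))%N%:R.
Proof.
rewrite /avg_step (eq_bigr (fun b : 'I_N => block_avg r a b * (k <= a %/ 2 ^ r)%N%:R)).
  by rewrite -big_distrl /= sum_block_avg -natrM mulnb.
move=> b _; rewrite /block_avg; case: andP => [[am /andP[bm /eqP ->]]|_]; last by rewrite !mul0r.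
by rewrite /step leq_divRL ?expn_gt0.
Qed.

Lemma avg_step_ge0 r x a : 0 <= avg_step r x a.
Proof. by apply: sumr_ge0 => b _; rewrite mulr_ge0 ?block_avg_ge0. Qed.

Lemma avg_step_le1 r x a : avg_step r x a <= 1.
Proof.
apply: (@le_trans _ _ (\sum_(b < N) block_avg r a b)); last first.
  by rewrite sum_block_avg; case: ltnP.
by apply: ler_sum => b _; rewrite ler_piMr ?block_avg_ge0 // /step; case: leqP.
Qed.

(* As a function of [x], the average of the step at [x] over a block is affine
   inside a block: the jump at [x] moves mass between the two ends. *)
Lemma avg_step_convex r x (q := (x %/ 2 ^ r)%N) :
  exists2 t : R, 0 <= t <= 1 & forall a,
    avg_step r x a = t * avg_step r (q * 2 ^ r) a
                     + (1 - t) * avg_step r (q.+1 * 2 ^ r) a.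
Proof.
(* The weight is the fraction of the block of [x] lying at or after [x]; it is 0 when [m <= x]. *)
exists (avg_step r x x); first by rewrite avg_step_ge0 avg_step_le1.
move=> a; rewrite !avg_step_start; case: (eqVneq (a %/ 2 ^ r)%N q) => [aq|aq]; last first.
  rewrite avg_step_out // -/q; case: (ltnP a m) => _ /=; last by rewrite !mulr0 addr0.
  rewrite (_ : (q < a %/ 2 ^ r) = (q <= a %/ 2 ^ r))%N; last by lia.
  by rewrite -mulrDl addrC subrK mul1r.
rewrite aq leqnn ltnn andbF mulr0 addr0 andbT.
case: (ltnP a m) => am; last first.
  by rewrite mulr0 /avg_step big1 // => b _; rewrite /block_avg ltnNge am !mul0r.
rewrite mulr1; case: (ltnP x m) => xm.
  apply: eq_bigr => b _; rewrite /block_avg am xm aq /=.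
  by rewrite (@eq_block_size r a x).
rewrite /avg_step [RHS]big1; last by move=> b _; rewrite /block_avg ltnNge xm !mul0r.
rewrite big1 // => b _; rewrite /block_avg /step; case: (ltnP b m) => bm; last by rewrite andbF !mul0r.
by rewrite (leqNgt x) (leq_trans bm xm) mulr0.
Qed.

End Averaging.

Section Haar.
Variables (R : realFieldType) (m N L : nat).
Hypotheses (mN : (m <= N)%N) (mL : (m <= 2 ^ L)%N) (Lm : (2 ^ L <= 2 * m)%N).

Let A l a b : R := block_avg R m (L - l) a b.

(** Martingale increments: level 0 is the overall mean, and levels above [L] vanish because [L - l]
    is then truncated to 0. *)
Definition haar_proj (l a b : nat) : R :=
  A l a b - (if l is l'.+1 then A l' a b else 0).

Definition haar_step (l x a : nat) : R := \sum_(b < N) haar_proj l a b * step R x b.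

Lemma haar_proj_sym l a b : haar_proj l a b = haar_proj l b a.
Proof.
rewrite /haar_proj /A block_avg_sym; case: l => // l.
by rewrite (block_avg_sym _ _ _ a).
Qed.

Lemma haar_proj_avg l s a c : (l <= s)%N ->
  \sum_(b < N) haar_proj l a b * A s b c = haar_proj l a c.
Proof.
move=> ls; under eq_bigr do rewrite mulrBl.
rewrite sumrB (block_avg_comp_fine _ mN) ?leq_sub2l //; congr (_ - _).
case: l ls => [_|l ls]; first by rewrite big1 // => b _; rewrite mul0r.
by rewrite (block_avg_comp_fine _ mN) // leq_sub2l // ltnW.
Qed.

Lemma haar_proj_avg_lt l s a c : (s < l)%N ->
  \sum_(b < N) haar_proj l a b * A s b c = 0.
Proof.
case: l => // l sl; under eq_bigr do rewrite mulrBl.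
by rewrite sumrB !(block_avg_comp _ mN) ?subrr // leq_sub2l // ltnW.
Qed.

(** Orthogonality of increments: the higher level is a difference of two averages, and when the
    levels differ the lower one absorbs both, so that they cancel. *)
Lemma haar_proj_comp l k a c :
  \sum_(b < N) haar_proj l a b * haar_proj k b c = (l == k)%:R * haar_proj l a c.
Proof.
wlog lk : l k a c / (l <= k)%N => [H|].
  case: (leqP l k) => [/H //|kl].
  have := H k l c a (ltnW kl); rewrite (ltn_eqF kl) (gtn_eqF kl) !mul0r => H0.
  rewrite -[RHS]H0.
  by apply: eq_bigr => b _; rewrite mulrC [X in X * _]haar_proj_sym [X in _ * X]haar_proj_sym.
under eq_bigr do rewrite mulrBr.
rewrite sumrB haar_proj_avg //; case: k lk => [|k lk].
  by rewrite leqn0 => /eqP ->; rewrite big1 ?subr0 ?mul1r // => b _; rewrite mulr0.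
case: ltngtP lk => // [lk _|-> _]; last by rewrite haar_proj_avg_lt // subr0 mul1r.
by rewrite haar_proj_avg // subrr mul0r.
Qed.

Lemma sum_haar_proj K a b : (L < K)%N ->
  \sum_(l < K) haar_proj l a b = ((a < m)%N && (a == b))%:R.
Proof.
case: K => // K LK; rewrite -block_avg0.
have -> : \sum_(l < K.+1) haar_proj l a b = A K a b.
  elim: K {LK} => [|K IH]; first by rewrite big_ord1 /haar_proj subr0.
  by rewrite big_ord_recr /= IH /haar_proj addrC subrK.
by rewrite /A (_ : (L - K = 0)%N) //; apply/eqP; rewrite subn_eq0.
Qed.

Lemma haar_proj_diag l a : haar_proj l a a = \sum_(b < N) haar_proj l a b ^+ 2.
Proof.
have := haar_proj_comp l l a a; rewrite eqxx mul1r => <-.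
by apply: eq_bigr => b _; rewrite [X in _ * X]haar_proj_sym expr2.
Qed.

Lemma haar_proj_diag_ge0 l a : 0 <= haar_proj l a a.
Proof. by rewrite haar_proj_diag sumr_ge0 // => b _; rewrite sqr_ge0. Qed.

Lemma haar_proj_trace l : \sum_(a < N) haar_proj l a a <= 2 ^+ l.
Proof.
clear Lm; apply: (@le_trans _ _ (\sum_(a < N) A l a a)).
  apply: ler_sum => a _; rewrite /haar_proj gerBl.
  by case: l => // l; rewrite block_avg_ge0.
rewrite -natrX; apply: block_avg_trace => //.
rewrite -expnD; apply: (leq_trans mL); rewrite leq_exp2l //; lia.
Qed.

Lemma haar_stepE l x a : haar_step l x a = avg_step R m N (L - l) x a -
  (if l is l'.+1 then avg_step R m N (L - l') x a else 0).
Proof.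
rewrite /haar_step; under eq_bigr do rewrite mulrBl.
rewrite sumrB; congr (_ - _); case: l => // .
by rewrite big1 // => b _; rewrite mul0r.
Qed.

Lemma haar_step_at0 l a : (0 < l)%N -> haar_step l 0 a = 0.
Proof.
case: l => // l _; rewrite haar_stepE /avg_step.
under eq_bigr do rewrite mulr1.
under [X in _ - X]eq_bigr do rewrite mulr1.
by rewrite !sum_block_avg // subrr.
Qed.

Lemma haar_proj_out l a b : (m <= a)%N -> haar_proj l a b = 0.
Proof.
move=> ma; rewrite /haar_proj /A /block_avg ltnNge ma /= mul0r.
by case: l => [|l]; rewrite ?mul0r subrr.
Qed.

Lemma haar_step_out l x a : (m <= a)%N -> haar_step l x a = 0.
Proof.
by move=> ma; rewrite /haar_step big1 // => b _; rewrite haar_proj_out ?mul0r.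
Qed.

(** The component has values in [[-1, 1]] and vanishes off the block of length [2 ^ (L - l.-1)]
    containing [x], since other blocks see a constant step. The factor 4 comes from [2 ^ L <= 2 * m]
    and from the passage to the parent block. *)
Lemma haar_step_norm l x :
  \sum_(a < N) haar_step l x a ^+ 2 <= 4 * m%:R / 2 ^+ l.
Proof.
have bnd r : \sum_(a < N) haar_step l x a ^+ 2 <=
      \sum_(a < N) ((a < m) && (a %/ 2 ^ r == x %/ 2 ^ r))%N%:R ->
    \sum_(a < N) haar_step l x a ^+ 2 <= (2 ^ r)%N%:R.
  move=> /le_trans; apply.
  rewrite (eq_bigr (fun a : 'I_N =>
    if (a < m)%N then (a %/ 2 ^ r == x %/ 2 ^ r)%N%:R else 0)); last first.
    by move=> a _; case: ifP.
  rewrite -big_mkcond /= -(big_ord_widen N (fun b => (b %/ 2 ^ r == x %/ 2 ^ r)%N%:R)) //.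
  by rewrite -natr_sum ler_nat block_size_le.
have sq a : `|haar_step l x a| <= 1.
  rewrite haar_stepE; have := avg_step_ge0 R m N (L - l) x a.
  have := @avg_step_le1 R m N mN (L - l) x a; case: l {bnd} => [|l].
    by rewrite subr0 => ? ?; rewrite ger0_norm.
  have := avg_step_ge0 R m N (L - l) x a.
  have := @avg_step_le1 R m N mN (L - l) x a.
  by move=> *; rewrite ler_norml; apply/andP; split; lra.
have sq1 a : haar_step l x a ^+ 2 <= 1.
  by rewrite -real_normK ?num_real // expr_le1 // sq.
(* Beyond level [L] both averages have resolution 0, so the component is zero. *)
case: (leqP l L) => lL; last first.
  rewrite big1 ?divr_ge0 ?mulr_ge0 ?exprn_ge0 //= => a _.
  rewrite haar_stepE; case: l lL {bnd sq sq1} => [|l] lL //.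
  have /eqP -> : (L - l.+1 == 0)%N by rewrite subn_eq0 ltnW.
  have /eqP -> : (L - l == 0)%N by rewrite subn_eq0 -ltnS.
  by rewrite subrr expr0n.
have pl : (2 ^ (L - l.-1))%N%:R <= 4 * m%:R / 2 ^+ l :> R.
  rewrite ler_pdivlMr ?exprn_gt0 // -natrX -!natrM ler_nat -expnD.
  apply: (@leq_trans (2 ^ L.+1)%N); first by rewrite leq_exp2l //; lia.
  by rewrite expnS; lia.
apply: le_trans pl; apply: bnd; apply: ler_sum => a _.
case: (ltnP a m) => am /=; last by rewrite haar_step_out // expr0n.
case: eqP => [_|/eqP ax] //=.
case: l lL sq sq1 ax => [lL _ _|l lL _ _ /= ax].
  rewrite /= subn0 => ax; rewrite haar_stepE subr0 subn0 avg_step_out // am /=.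
  move: ax; rewrite (divn_small (leq_trans am mL)) eq_sym -lt0n ltnNge => /negPf -> /=.
  by rewrite expr0n.
have rr : (L - l = (L - l.+1) + 1)%N by lia.
have ax' : (a %/ 2 ^ (L - l.+1) != x %/ 2 ^ (L - l.+1))%N.
  by apply: contra ax => /eqP e; rewrite rr expnD !divnMA e.
rewrite haar_stepE !avg_step_out // rr.
rewrite expnD !divnMA am /=.
(* Fine blocks are ordered like their parents, because the parents differ. *)
rewrite (_ : (_ %/ _ %/ _ <= _)%N = (x %/ 2 ^ (L - l.+1) <= a %/ 2 ^ (L - l.+1))%N).
  by rewrite subrr expr0n.
by move: ax; rewrite rr expnD !divnMA; move: ax'; lia.
Qed.

Lemma haar_step_orth (l k x : nat) : l != k ->
  \sum_(a < N) haar_step l x a * haar_step k x a = 0.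
Proof.
move=> lk.
have -> : \sum_(a < N) haar_step l x a * haar_step k x a =
    \sum_(b < N) \sum_(c < N) \sum_(a < N)
      haar_proj l b a * haar_proj k a c * (step R x b * step R x c).
  under eq_bigr do rewrite big_distrlr /=.
  rewrite exchange_big /=; apply: eq_bigr => b _; rewrite exchange_big /=.
  apply: eq_bigr => c _; apply: eq_bigr => e _.
  by rewrite (haar_proj_sym l e) mulrACA.
rewrite big1 // => b _; rewrite big1 // => c _.
by rewrite -big_distrl /= haar_proj_comp (negPf lk) !mul0r.
Qed.

(** Levels up to [s] factor through averaging at resolution [L - s], so the convexity of the
    averaged step passes to all of them. That [t] does not depend on [l] is what lets the weights be
    multiplied across axes. *)
Lemma haar_step_convex s x (q := (x %/ 2 ^ (L - s))%N) :
  exists2 t : R, 0 <= t <= 1 & forall l a, (l <= s)%N ->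
    haar_step l x a = t * haar_step l (q * 2 ^ (L - s)) a
                     + (1 - t) * haar_step l (q.+1 * 2 ^ (L - s)) a.
Proof.
have [t t01 tE] := @avg_step_convex R m N mN (L - s) x.
exists t => // l a ls.
have E y : haar_step l y a = \sum_(c < N) haar_proj l a c * avg_step R m N (L - s) y c.
  rewrite /avg_step; under [RHS]eq_bigr do rewrite big_distrr /=.
  rewrite exchange_big /=; apply: eq_bigr => b _; rewrite -(haar_proj_avg _ _ ls).
  by rewrite big_distrl /=; apply: eq_bigr => c _; rewrite mulrA.
rewrite !E !big_distrr -big_split /=; apply: eq_bigr => c _.
by rewrite tE -/q; ring.
Qed.

End Haar.

(** * Tensor products *)

(** The prescribed sum determines the first entry from the [d - 1] others, each at most [s]. *)
Lemma card_level (d K s : nat) : (0 < d)%N ->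
  (#|[pred j : {ffun 'I_d -> 'I_K} | \sum_i j i == s]| <= s.+1 ^ d.-1)%N.
Proof.
case: d => // d _ /=.
pose F (j : {ffun 'I_d.+1 -> 'I_K}) : {ffun 'I_d -> 'I_s.+1} :=
  [ffun i => inord (j (lift ord0 i))].
rewrite -[s.+1 in leqRHS]card_ord -[d in leqRHS]card_ord -card_ffun.
rewrite -(@card_in_image _ _ F); first exact: max_card.
have le (j : {ffun 'I_d.+1 -> 'I_K}) i : (\sum_i j i)%N == s -> (j i < s.+1)%N.
  by move=> /eqP <-; rewrite ltnS (bigD1 i) //= leq_addr.
move=> j k; rewrite !inE => js ks /ffunP jk.
have jkl i : j (lift ord0 i) = k (lift ord0 i) :> nat.
  by have := congr1 val (jk i); rewrite !ffunE /= !inordK ?le.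
apply/ffunP => i; apply/val_inj; case: (unliftP ord0 i) => [i' ->|->] //=.
move: js ks; rewrite !big_ord_recl => /eqP <-.
by rewrite (eq_bigr _ (fun i _ => jkl i)) eqn_add2r => /eqP ->.
Qed.

Section Tensor.
Variables (R : realFieldType) (d N K : nat) (m L : 'I_d -> nat).
Hypotheses (d0 : (0 < d)%N) (mN : forall i, (m i <= N)%N).
Hypotheses (mL : forall i, (m i <= 2 ^ L i)%N) (Lm : forall i, (2 ^ L i <= 2 * m i)%N).
Hypothesis LK : forall i, (L i < K)%N.

Local Notation point := {ffun 'I_d -> 'I_N}.
Local Notation levels := {ffun 'I_d -> 'I_K}.
Local Notation hproj i := (haar_proj R (m i) (L i)).
Local Notation hstep i := (haar_step R (m i) N (L i)).

Definition box : pred point := fun g => [forall i, (g i < m i)%N].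
Definition level_of (j : levels) : nat := \sum_i j i.

Definition orthant (y : 'I_d -> nat) (g : point) : R := \prod_i step R (y i) (g i).
Definition tensor_proj (j : levels) (g h : point) : R :=
  \prod_i hproj i (j i) (g i) (h i).
Definition tensor_step (j : levels) (y : 'I_d -> nat) (g : point) : R :=
  \prod_i hstep i (j i) (y i) (g i).

Lemma tensor_stepE j y g : tensor_step j y g = \sum_h tensor_proj j g h * orthant y h.
Proof.
rewrite /tensor_step /haar_step bigA_distr_bigA /=.
by apply: eq_bigr => h _; rewrite -big_split.
Qed.

Lemma tensor_proj_sym j g h : tensor_proj j g h = tensor_proj j h g.
Proof. by apply: eq_bigr => i _; rewrite haar_proj_sym. Qed.

Lemma prod_eq_ffun (j k : levels) : \prod_i (j i == k i)%:R = (j == k)%:R :> R.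
Proof.
case: eqP => [->|/eqP jk]; first by rewrite big1 // => i _; rewrite eqxx.
have [i ji] : exists i, j i != k i.
  apply/existsP; apply: contraNT jk; rewrite negb_exists => /forallP H.
  by apply/eqP/ffunP => i; apply/eqP; rewrite -[_ == _]negbK.
by rewrite (bigD1 i) //= (negPf ji) mul0r.
Qed.

Lemma tensor_proj_comp j k g e :
  \sum_h tensor_proj j g h * tensor_proj k h e = (j == k)%:R * tensor_proj j g e.
Proof.
rewrite -prod_eq_ffun -big_split /=.
under [RHS]eq_bigr do rewrite -(haar_proj_comp R (L _) (mN _)).
by rewrite bigA_distr_bigA /=; apply: eq_bigr => h _; rewrite -big_split.
Qed.

Lemma sum_tensor_proj g h : \sum_j tensor_proj j g h = (box g && (g == h))%:R.
Proof.
rewrite /tensor_proj -(bigA_distr_bigA (fun i (l : 'I_K) => hproj i l (g i) (h i))) /=.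
under eq_bigr do rewrite sum_haar_proj //.
case: (boolP (box g)) => [/forallP bg|]; last first.
  by rewrite negb_forall => /existsP[i /negPf gi]; rewrite (bigD1 i) //= gi mul0r.
under eq_bigr do rewrite bg.
rewrite /=; case: eqP => [->|/eqP gh]; first by rewrite big1 // => i _; rewrite eqxx.
have [i gi] : exists i, g i != h i.
  apply/existsP; apply: contraNT gh; rewrite negb_exists => /forallP H.
  by apply/eqP/ffunP => i; apply/eqP; rewrite -[_ == _]negbK.
by rewrite (bigD1 i) //= [_ == _](negPf gi) mul0r.
Qed.

Lemma sum_tensor_step y g : box g -> \sum_j tensor_step j y g = orthant y g.
Proof.
move=> bg; under eq_bigr do rewrite tensor_stepE.
rewrite exchange_big /= (bigD1 g) //= [X in _ + X]big1 ?addr0 => [|h hg].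
  by rewrite -big_distrl /= sum_tensor_proj bg eqxx mul1r.
by rewrite -big_distrl /= sum_tensor_proj eq_sym (negPf hg) andbF mul0r.
Qed.

Lemma tensor_proj_out j g h : ~~ box g -> tensor_proj j g h = 0.
Proof.
rewrite negb_forall => /existsP[i]; rewrite -leqNgt => gi.
by rewrite /tensor_proj (bigD1 i) //= haar_proj_out ?mul0r.
Qed.

Lemma tensor_step_out j y g : ~~ box g -> tensor_step j y g = 0.
Proof.
by move=> bg; rewrite tensor_stepE big1 // => h _; rewrite tensor_proj_out ?mul0r.
Qed.

(** Orthogonal projection onto the hyperbolic cross. *)
Definition low_proj J g h : R := \sum_(j | (level_of j <= J)%N) tensor_proj j g h.

Lemma low_proj_diag J g : low_proj J g g = \sum_h low_proj J g h ^+ 2.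
Proof.
under eq_bigr do rewrite expr2 big_distrlr /=.
rewrite exchange_big /=; apply: eq_bigr => j jJ; rewrite exchange_big (bigD1 j) //=.
under eq_bigr do rewrite [X in _ * X]tensor_proj_sym.
rewrite tensor_proj_comp eqxx mul1r big1 ?addr0 // => k /andP[_ kj].
under eq_bigr do rewrite [X in _ * X]tensor_proj_sym.
by rewrite tensor_proj_comp eq_sym (negPf kj) mul0r.
Qed.

(** A single level vector [j] has trace at most [2 ^ level_of j]; [card_level] counts the vectors of
    each total level, and a geometric sum over the levels concludes. *)
Lemma low_proj_trace J :
  \sum_g low_proj J g g <= J.+1%:R ^+ d.-1 * 2 ^+ J.+1.
Proof.
apply: (@le_trans _ _ (\sum_(j | (level_of j <= J)%N) 2 ^+ level_of j)).
  rewrite exchange_big /=; apply: ler_sum => j _.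
  rewrite /tensor_proj -(bigA_distr_bigA (fun i (a : 'I_N) => hproj i (j i) a a)) /=.
  rewrite /level_of expr_sum; apply: ler_prod => i _.
  by rewrite haar_proj_trace // andbT sumr_ge0 // => a _;
    rewrite (haar_proj_diag_ge0 R (L i) (mN i)).
have -> : \sum_(j | (level_of j <= J)%N) 2 ^+ level_of j =
    \sum_(s < J.+1) \sum_(j | level_of j == s) (2 ^+ s : R).
  rewrite (partition_big (fun j => inord (level_of j) : 'I_J.+1) predT) //=.
  apply: eq_bigr => s _; rewrite (eq_bigl (fun j => level_of j == s)).
    by apply: eq_bigr => j /eqP ->.
  move=> j; apply/andP/eqP => [[jJ /eqP <-]|->]; first by rewrite inordK.
  by rewrite -ltnS ltn_ord; split => //; apply/eqP/val_inj; rewrite /= inordK.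
apply: (@le_trans _ _ (\sum_(s < J.+1) J.+1%:R ^+ d.-1 * 2 ^+ s)).
  apply: ler_sum => s _; rewrite sumr_const -[_ *+ _]mulr_natl ler_wpM2r ?exprn_ge0 //.
  rewrite -natrX ler_nat; apply: leq_trans (card_level K s d0) _.
  by case: d.-1 => // e; rewrite leq_exp2r // ltn_ord.
rewrite -big_distrr /= ler_wpM2l ?exprn_ge0 //.
have := subrX1 (2 : R) J.+1; rewrite (_ : 2 - 1 = 1 :> R); last by ring.
by rewrite mul1r => <-; rewrite gerBl.
Qed.

Definition level_step (s : nat) y g : R := \sum_(j | level_of j == s) tensor_step j y g.

(** Components with distinct level vectors are orthogonal, since they are so along some axis; the
    one-axis norm bounds multiply, and [card_level] counts the components. *)
Lemma level_step_norm (s : nat) y :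
  \sum_g level_step s y g ^+ 2 <=
    s.+1%:R ^+ d.-1 * (4 ^+ d * (\prod_i m i)%:R / 2 ^+ s).
Proof.
have -> : \sum_g level_step s y g ^+ 2 =
    \sum_(j | level_of j == s) \sum_g tensor_step j y g ^+ 2.
  under eq_bigr do rewrite expr2 big_distrlr /=.
  rewrite exchange_big /=; apply: eq_bigr => j js; rewrite exchange_big (bigD1 j) //=.
  rewrite [X in _ + X]big1 ?addr0 => [|k /andP[_ kj]].
    by apply: eq_bigr => g _; rewrite expr2.
  have [i ki] : exists i, j i != k i.
    apply/existsP; apply: contraNT kj; rewrite negb_exists => /forallP H.
    by apply/eqP/ffunP => i; apply/esym/eqP; rewrite -[_ == _]negbK.
  rewrite /tensor_step; under eq_bigr do rewrite -big_split /=.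
  rewrite -(bigA_distr_bigA (fun i (a : 'I_N) => hstep i (j i) (y i) a * hstep i (k i) (y i) a)).
  by rewrite (bigD1 i) //= (haar_step_orth R (L i) (mN i)) ?mul0r.
apply: (@le_trans _ _ (\sum_(j | level_of j == s) (4 ^+ d * (\prod_i m i)%:R / 2 ^+ s))).
  apply: ler_sum => j /eqP <-.
  rewrite [leLHS](eq_bigr (fun g : point =>
    \prod_i (hstep i (j i) (y i) (g i) * hstep i (j i) (y i) (g i)))); last first.
    by move=> g _; rewrite expr2 big_split.
  rewrite -(bigA_distr_bigA (fun i (a : 'I_N) =>
    hstep i (j i) (y i) a * hstep i (j i) (y i) a)) /=.
  have -> : 4 ^+ d * (\prod_i m i)%:R / 2 ^+ level_of j = \prod_i (4 * (m i)%:R / 2 ^+ j i) :> R.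
    rewrite !big_split /= prodr_const card_ord natr_prod; congr (_ * _).
    by rewrite /level_of expr_sum prodfV.
  apply: ler_prod => i _; under eq_bigr do rewrite -expr2.
  rewrite haar_step_norm // andbT.
  by rewrite sumr_ge0 // => a _; rewrite sqr_ge0.
have c0 : 0 <= 4 ^+ d * (\prod_i m i)%:R / 2 ^+ s :> R.
  by rewrite divr_ge0 ?mulr_ge0 ?exprn_ge0.
rewrite sumr_const -[_ *+ _]mulr_natl; apply: (ler_wpM2r c0).
by rewrite -natrX ler_nat; apply: card_level.
Qed.

(** The orthant at the origin is constant. Its coefficient, which the variation does not control,
    therefore never reaches the positive levels. *)
Lemma level_step_at0 (s : nat) y g : (0 < s)%N -> (forall i, y i = 0%N) ->
  level_step s y g = 0.
Proof.
move=> s0 y0; rewrite /level_step big1 // => j /eqP js.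
have [i ji] : exists i, (0 < j i)%N.
  apply/existsP; apply: contraLR s0; rewrite negb_exists => /forallP H.
  rewrite -js -leqNgt leqn0 /level_of sum_nat_eq0; apply/forallP => i.
  by have := H i; rewrite -leqNgt leqn0.
by rewrite /tensor_step (bigD1 i) //= y0 haar_step_at0 ?mul0r.
Qed.

Definition corner s (k : {ffun 'I_d -> 'I_(2 ^ s).+1}) : 'I_d -> nat :=
  fun i => (k i * 2 ^ (L i - s))%N.

(* On the components of level [s] the orthant at [y] is a convex combination of
   the orthants at the [2 ^ d] surrounding points of the dyadic grid of
   resolution [s]. *)
Lemma level_step_corners s (y : 'I_d -> nat) (Z : point -> R) (B : R) :
  (forall i, (y i < 2 ^ L i)%N) ->
  (forall k, `|\sum_g Z g * level_step s (@corner s k) g| <= B) ->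
  `|\sum_g Z g * level_step s y g| <= B.
Proof.
move=> yL HB.
have /fin_all_exists2[t t01 tE] := fun i => haar_step_convex R (L i) (mN i) s (y i).
pose w (e : {ffun 'I_d -> bool}) := \prod_i (if e i then 1 - t i else t i).
have w0 e : 0 <= w e.
  by apply: prodr_ge0 => i _; have /andP[? ?] := t01 i; case: ifP => _ //; rewrite subr_ge0.
have w1 : \sum_e w e = 1.
  rewrite /w -(bigA_distr_bigA (fun i (b : bool) => if b then 1 - t i else t i)) /=.
  by rewrite big1 // => i _; rewrite big_bool /= subrK.
(* Vertex [e] of the dyadic cell of [y]. An index may equal [2 ^ s], the far end of the last block,
   hence the [(2 ^ s).+1] values per axis. *)
pose c (e : {ffun 'I_d -> bool}) : {ffun 'I_d -> 'I_(2 ^ s).+1} :=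
  [ffun i => inord (y i %/ 2 ^ (L i - s) + e i)].
have qs i : (y i %/ 2 ^ (L i - s) < 2 ^ s)%N.
  rewrite ltn_divLR ?expn_gt0 // -expnD; apply: leq_trans (yL i) _.
  by rewrite leq_exp2l //; lia.
have E g : level_step s y g = \sum_e w e * level_step s (@corner s (c e)) g.
  rewrite /level_step; under [RHS]eq_bigr do rewrite big_distrr /=.
  rewrite exchange_big /=; apply: eq_bigr => j /eqP js.
  rewrite /tensor_step (eq_bigr (fun i => \sum_(b : bool) (if b then 1 - t i else t i) *
      hstep i (j i) ((y i %/ 2 ^ (L i - s) + b) * 2 ^ (L i - s)) (g i))).
    rewrite bigA_distr_bigA /=; apply: eq_bigr => e _; rewrite big_split /=; congr (_ * _).
    apply: eq_bigr => i _; rewrite /corner /c ffunE inordK //.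
    by have := qs i; case: (e i) => /=; lia.
  move=> i _; rewrite big_bool /= addn0 addn1 addrC -tE //.
  by rewrite -js /level_of (bigD1 i) //= leq_addr.
under eq_bigr do rewrite E big_distrr /=.
rewrite exchange_big /=; apply: le_trans (ler_norm_sum _ _ _) _.
rewrite -[B]mul1r -w1 big_distrl /=; apply: ler_sum => e _.
under eq_bigr do rewrite mulrCA.
by rewrite -big_distrr normrM /= ger0_norm // ler_wpM2l.
Qed.

Definition low_noise J (Z : point -> R) h : R := \sum_g Z g * low_proj J g h.

(** The low levels are kept in terms of [D], ready for Cauchy-Schwarz, and the high ones in terms of
    the coefficients, ready for an l1 bound against a maximum. No level exceeds [d * K]. *)
Lemma noise_decomposition J (Z beta D : point -> R) :
  (forall g, box g -> D g = \sum_(k | box k) beta k * orthant (fun i => k i) g) ->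
  \sum_(g | box g) Z g * D g =
  \sum_(h | box h) low_noise J Z h * D h +
  \sum_(J.+1 <= s < (d * K).+1) \sum_(k | box k)
      beta k * \sum_g Z g * level_step s (fun i => k i) g.
Proof.
move=> DE.
pose X (j : levels) := \sum_(k | box k) beta k * \sum_g Z g * tensor_step j (fun i => k i) g.
have full : \sum_(g | box g) Z g * D g = \sum_j X j.
  rewrite exchange_big /=.
  rewrite (eq_bigr (fun g =>
    \sum_(k | box k) beta k * (Z g * orthant (fun i => k i) g))); last first.
    by move=> g bg; rewrite DE // big_distrr; apply: eq_bigr => k _; rewrite mulrCA.
  rewrite exchange_big /=; apply: eq_bigr => k _; rewrite -!big_distrr /=; congr (_ * _).
  rewrite exchange_big [LHS]big_mkcond /=; apply: eq_bigr => g _.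
  rewrite -big_distrr /=; case: ifP => bg; first by rewrite sum_tensor_step.
  by rewrite big1 ?mulr0 // => j _; rewrite tensor_step_out ?bg.
rewrite full (bigID (fun j => (level_of j <= J)%N)) /=; congr (_ + _).
  under [RHS]eq_bigr do rewrite /low_noise.
  rewrite [RHS](eq_bigr (fun h => \sum_(k | box k) beta k *
    \sum_g \sum_(j | (level_of j <= J)%N)
      Z g * (tensor_proj j g h * orthant (fun i => k i) h))); last first.
    move=> h bh; rewrite DE // big_distrlr /= exchange_big /=; apply: eq_bigr => k _.
    rewrite big_distrr /=; apply: eq_bigr => g _.
    rewrite -big_distrr -big_distrl /= -/(low_proj J g h).
    ring.
  rewrite exchange_big /= [RHS]exchange_big; apply: eq_bigr => k _ /=.
  rewrite -!big_distrr /=; congr (_ * _).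
  rewrite exchange_big /= [RHS]exchange_big /=; apply: eq_bigr => g _.
  rewrite exchange_big /=; apply: eq_bigr => j _.
  rewrite -big_distrr /=; congr (_ * _); rewrite tensor_stepE [RHS]big_mkcond /=.
  apply: eq_bigr => h _; case: ifP => // bh.
  by rewrite tensor_proj_sym tensor_proj_out ?bh ?mul0r.
rewrite exchange_big [RHS]exchange_big /=; apply: eq_bigr => k _.
rewrite -!big_distrr /=; congr (_ * _); rewrite exchange_big [RHS]exchange_big /=.
apply: eq_bigr => g _; rewrite -!big_distrr /=; congr (_ * _).
under [RHS]eq_bigr do rewrite /level_step big_mkcond /=.
rewrite exchange_big [LHS]big_mkcond /=; apply: eq_bigr => j _.
under eq_bigr do rewrite eq_sym.
(* Each [j] is met for the single value [s = level_of j]. *)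
rewrite -big_mkcond big_nat1_eq -ltnNge.
case: ltnP => //= Jj; rewrite (_ : (level_of j < (d * K).+1)%N) //.
rewrite ltnS /level_of -[d in (d * K)%N]card_ord -sum_nat_const.
by apply: leq_sum => i _; apply: ltnW.
Qed.

(** By [a * b <= a ^+ 2 + b ^+ 2 / 4] the low levels cost, after doubling, half of the squared norm
    of [D], absorbed on the left. The high levels cost [W] times the maximum over the corners, the
    index [k = 0] dropping out. *)
Lemma basic_inequality J (Z beta D : point -> R) (W : R) (B : nat -> R) :
  (forall g, box g -> D g = \sum_(k | box k) beta k * orthant (fun i => k i) g) ->
  \sum_(k | box k && [exists i, (0 < k i)%N]) `|beta k| <= W ->
  (forall s k, (J < s)%N -> `|\sum_g Z g * level_step s (@corner s k) g| <= B s) ->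
  \sum_(g | box g) D g ^+ 2 <= 2 * \sum_(g | box g) Z g * D g ->
  \sum_(g | box g) D g ^+ 2 <=
    4 * \sum_h low_noise J Z h ^+ 2 + 4 * W * \sum_(J.+1 <= s < (d * K).+1) B s.
Proof.
move=> DE bW ZB; rewrite (noise_decomposition J Z DE); set S := \sum_(g | box g) D g ^+ 2.
have low : \sum_(h | box h) low_noise J Z h * D h <= \sum_h low_noise J Z h ^+ 2 + S / 4.
  apply: (@le_trans _ _ (\sum_(h | box h) (low_noise J Z h ^+ 2 + D h ^+ 2 / 4))).
    apply: ler_sum => h _; have := sqr_ge0 (low_noise J Z h - D h / 2).
    by rewrite sqrrB !expr2; lra.
  rewrite big_split /= -big_distrl lerD2r [leLHS]big_mkcond /=.
  by apply: ler_sum => h _; case: ifP => // _; rewrite sqr_ge0.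
have high : \sum_(J.+1 <= s < (d * K).+1) \sum_(k | box k)
      beta k * \sum_g Z g * level_step s (fun i => k i) g
    <= W * \sum_(J.+1 <= s < (d * K).+1) B s.
  rewrite big_distrr !big_nat /=; apply: ler_sum => s /andP[Js _].
  have B0 : 0 <= B s by apply: le_trans (ZB s [ffun=> ord0] Js).
  rewrite (bigID (fun k : point => [exists i, (0 < k i)%N])) /= [X in _ + X]big1 ?addr0.
    apply: le_trans (ler_norm _) _; apply: le_trans (ler_norm_sum _ _ _) _.
    apply: (@le_trans _ _
      (\sum_(k | box k && [exists i, (0 < k i)%N]) `|beta k| * B s)); last first.
      by rewrite -big_distrl ler_wpM2r.
    apply: ler_sum => k /andP[/forallP bk _]; rewrite normrM ler_wpM2l //.
    by apply: level_step_corners => [i|c]; [apply: leq_trans (bk i) (mL i)|apply: ZB].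
  move=> k /andP[_]; rewrite negb_exists => /forallP k0.
  rewrite big1 ?mulr0 // => g _; rewrite level_step_at0 ?mulr0 //; first by case: (s) Js.
  by move=> i; apply/eqP; have := k0 i; rewrite -leqNgt leqn0.
move: low high; lra.
Qed.

End Tensor.

(** * Hardy-Krause variation and mixed differences *)

Section HardyKrause.
Variables (R : realType) (d N : nat) (m : 'I_d -> nat).
Hypotheses (m0 : forall i, (0 < m i)%N) (mN : forall i, (m i <= N)%N).

Local Notation point := {ffun 'I_d -> 'I_N}.

Definition lattice_point (h : 'I_d -> nat) : 'rV[R]_d :=
  \row_i ((h i)%:R / (m i)%:R).

(** Backward difference along every axis, values at index -1 being read as 0. The product kernel
    lets sums over the grid factor axis by axis. *)
Definition mixed_difference (f : 'rV[R]_d -> R) (k : point) : R :=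
  \sum_(h : point) f (lattice_point (fun i => h i)) *
    \prod_i \sum_(e < 2) (-1) ^+ e * (h i + e == k i)%N%:R.

(** One-axis inversion: [1[b <= g] - 1[b + 1 <= g] = 1[b = g]]. *)
Lemma sum_difference_step (b g : nat) : (b < N)%N -> (g < N)%N ->
  \sum_(a < N) (\sum_(e < 2) (-1) ^+ e * (b + e == a)%N%:R) * step R a g = (b == g)%:R.
Proof.
move=> bN gN.
have E (c : nat) : \sum_(a < N) (c == a)%N%:R * step R a g = ((c <= g)%N)%:R :> R.
  case: (ltnP c N) => cN.
    rewrite (bigD1 (Ordinal cN)) //= eqxx mul1r big1 ?addr0 // => a /negPf.
    by rewrite -val_eqE /= eq_sym => ->; rewrite mul0r.
  rewrite (leqNgt c) (leq_trans gN cN) big1 // => a _.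
  by rewrite (gtn_eqF (leq_trans (ltn_ord a) cN)) mul0r.
under eq_bigr do rewrite !big_ord_recl big_ord0 /= addn0 addn1 expr0 mul1r
  addr0 expr1 mulN1r mulrBl.
rewrite sumrB !E; case: ltngtP => _; rewrite ?subrr ?subr0 //.
Qed.

(** After exchanging sums, each axis is inverted by [sum_difference_step]; an orthant cornered
    outside the box misses [g]. *)
Lemma mixed_difference_expansion f (g : point) : box m g ->
  f (lattice_point (fun i => g i)) =
  \sum_(k : point | box m k) mixed_difference f k * orthant R (fun i => k i) g.
Proof.
move=> bg; rewrite [RHS](_ : _ = \sum_k mixed_difference f k * orthant R (fun i => k i) g).
  under eq_bigr do rewrite big_distrl /=.
  rewrite exchange_big (bigD1 g) //= [X in _ = _ + X]big1 ?addr0 => [|h hg].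
    under eq_bigr do rewrite -mulrA -big_split /=.
    rewrite -big_distrr /= -(bigA_distr_bigA (fun i (a : 'I_N) =>
      (\sum_(e < 2) (-1) ^+ e * (g i + e == a)%N%:R) * step R a (g i))).
    by rewrite big1 ?mulr1 // => i _; rewrite sum_difference_step // eqxx.
  under eq_bigr do rewrite -mulrA -big_split /=.
  rewrite -big_distrr /= -(bigA_distr_bigA (fun i (a : 'I_N) =>
      (\sum_(e < 2) (-1) ^+ e * (h i + e == a)%N%:R) * step R a (g i))).
  have [i gi] : exists i, h i != g i.
    apply/existsP; apply: contraNT hg; rewrite negb_exists => /forallP H.
    by apply/eqP/ffunP => i; apply/eqP; rewrite -[_ == _]negbK.
  by rewrite (bigD1 i) //= sum_difference_step // [_ == _](negPf gi) mul0r mulr0.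
rewrite big_mkcond /=; apply: eq_bigr => k _; case: ifP => // /negbT.
rewrite negb_forall => /existsP[i]; rewrite -leqNgt => mk.
rewrite /orthant (bigD1 i) //= /step leqNgt (leq_trans _ mk) ?mul0r ?mulr0 //.
by have /forallP := bg; apply.
Qed.

Lemma mixed_differenceE f k : mixed_difference f k =
  \sum_(e : {ffun 'I_d -> 'I_2} | [forall i, (e i <= k i)%N])
    (-1) ^+ (\sum_i e i)%N * f (lattice_point (fun i => k i - e i)%N).
Proof.
rewrite /mixed_difference; under eq_bigr do rewrite bigA_distr_bigA big_distrr /=.
rewrite exchange_big [RHS]big_mkcond /=; apply: eq_bigr => e _.
under eq_bigr do rewrite big_split /= -expr_sum mulrCA.
rewrite -big_distrr /=; case: ifP => [/forallP ek|/negbT].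
  have kN i : (k i - e i < N)%N by apply: leq_ltn_trans (ltn_ord (k i)); rewrite leq_subr.
  congr (_ * _); rewrite (bigD1 [ffun i => Ordinal (kN i)]) //= [X in _ + X]big1 ?addr0.
    rewrite big1 ?mulr1 => [|i _]; last by rewrite ffunE /= subnK ?eqxx.
    by congr f; apply/rowP => i; rewrite !mxE ffunE.
  move=> h hk; have [i hi] : exists i, (h i + e i != k i)%N.
    apply/existsP; apply: contraNT hk; rewrite negb_exists => /forallP H.
    apply/eqP/ffunP => i; apply/val_inj; rewrite ffunE /=.
    by have := H i; rewrite negbK => /eqP <-; rewrite addnK.
  by rewrite (bigD1 i) //= (negPf hi) mul0r mulr0.
rewrite negb_forall => /existsP[i]; rewrite -ltnNge => ki.
rewrite [X in _ * X]big1 ?mulr0 // => h _.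
by rewrite (bigD1 i) //= (gtn_eqF (leq_trans ki (leq_addl _ _))) mul0r mulr0.
Qed.

Definition support (k : point) : {set 'I_d} := [set i | (0 < k i)%N].

(** The initial 0 is left out, as [itv_partition] expects; the list ends at 1, one step past the
    last lattice coordinate. *)
Definition lattice_partition (S : {set 'I_d}) (s : 'I_#|S|) : seq R :=
  [seq l.+1%:R / (m (enum_val s))%:R | l <- iota 0 (m (enum_val s))].

Lemma size_lattice_partition S s : size (@lattice_partition S s) = m (enum_val s).
Proof. by rewrite size_map size_iota. Qed.

Lemma nth_lattice_partition S s l : (l <= m (enum_val s))%N ->
  nth 0 (0 :: @lattice_partition S s) l = l%:R / (m (enum_val s))%:R.
Proof.
case: l => [_|l lm] /=; first by rewrite mul0r.
by rewrite (nth_map 0%N) ?size_iota // nth_iota.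
Qed.

Lemma lattice_partitionP S s : itv_partition 0 1 (@lattice_partition S s).
Proof.
have mi : (0 : R) < (m (enum_val s))%:R by rewrite ltr0n.
split.
  apply/(pathP 0) => l; rewrite size_lattice_partition => lm.
  rewrite nth_lattice_partition 1?ltnW // -[nth 0 _ l]/(nth 0 (0 :: lattice_partition s) l.+1).
  by rewrite nth_lattice_partition // ltr_pM2r ?invr_gt0 // ltr_nat.
rewrite -[last _ _]/(last 0 (0 :: lattice_partition s)) -nth_last [(size _).-1]/=.
rewrite size_lattice_partition nth_lattice_partition // divff //.
by rewrite gt_eqF.
Qed.

(** Along an axis where [k] is 0 only the shift 0 survives, which places the difference on the face
    of [S]; along the others it spans the cell just below [k]. *)
Lemma mixed_difference_quasi_volume f k S : box m k -> support k = S ->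
  mixed_difference f k = quasi_volume (@face_restriction R d f S)
    (\row_s ((k (enum_val s)).-1%:R / (m (enum_val s))%:R))
    (\row_s ((k (enum_val s))%:R / (m (enum_val s))%:R)).
Proof.
move=> bk <- {S}; set S := support k; rewrite mixed_differenceE /quasi_volume.
have ks (s : 'I_#|S|) : (0 < k (enum_val s))%N by have := enum_valP s; rewrite inE.
have mi i : ((m i)%:R : R) != 0 by rewrite pnatr_eq0 -lt0n.
(* Extension by 0 is a bijection onto the shifts bounded by [k], as [k] is positive exactly on
   [S]. *)
pose ext (j : {ffun 'I_#|S| -> 'I_2}) : {ffun 'I_d -> 'I_2} :=
  [ffun i => if [pick s | enum_val s == i] is Some s then j s else ord0].
have ext_in j (s : 'I_#|S|) : ext j (enum_val s) = j s.
  by rewrite ffunE; case: pickP => [s' /eqP/enum_val_inj ->//|/(_ s)]; rewrite eqxx.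
have ext_out j i : i \notin S -> ext j i = ord0.
  move=> iS; rewrite ffunE; case: pickP => // s /eqP si.
  by move: iS; rewrite -si enum_valP.
have val_of i : i \in S -> exists s : 'I_#|S|, enum_val s = i.
  by move=> iS; exists (enum_rank_in iS i); rewrite enum_rankK_in.
rewrite (reindex_onto ext (fun e => [ffun s => e (enum_val s)])) /=; last first.
  move=> e /forallP ek; apply/ffunP => i; case: (boolP (i \in S)) => [/val_of[s <-]|iS].
    by rewrite ext_in ffunE.
  rewrite ext_out //; apply/val_inj/eqP; rewrite eq_sym -leqn0 /=.
  by have := ek i; move: iS; rewrite inE -leqNgt leqn0 => /eqP ->.
apply: eq_big => [j|j _].
  rewrite (_ : [ffun s => _] == _); last first.
    by apply/eqP/ffunP => s; rewrite ffunE ext_in.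
  rewrite andbT; transitivity true; [apply/forallP => i|apply/esym/forallP => s].
    case: (boolP (i \in S)) => [/val_of[s <-]|/ext_out ->//].
    by rewrite ext_in; apply: leq_trans (ks s); rewrite -ltnS.
  (* The two endpoints differ on every axis of [S], so each [J_i] in the quasi-volume is 1. *)
  rewrite !mxE (_ : (_ != _) = true) -1?ltnS //.
  apply/eqP => /(mulIf (invr_neq0 (mi _)))/eqP; rewrite eqr_nat.
  by have := ks s; case: (k _ : nat) => //= x _; rewrite ltn_eqF.
congr (_ ^+ _ * f _).
  rewrite (bigID (mem S)) /= [X in (_ + X)%N]big1 ?addn0 => [|i iS]; last first.
    by rewrite ext_out.
  rewrite (big_enum_val (fun i => ext j i : nat)) /=.
  by apply: eq_bigr => s _; rewrite ext_in.
apply/rowP => i; rewrite !mxE; case: (boolP (i \in S)) => [/val_of[s <-]|iS].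
  rewrite (big_pred1 s) => [|s']; last by rewrite /= (inj_eq enum_val_inj).
  rewrite !mxE ext_in -mulrBl mulrA -mulrDl; congr (_ / _).
  have := ks s; case: (k _ : nat) => // x _ /=.
  by case: (j s) => [[|[|//]] p] /=; rewrite ?subn0 ?subn1 /= -?natr1; ring.
rewrite big_pred0 => [|s]; last by apply/negP => /eqP si; move: iS; rewrite -si enum_valP.
by rewrite ext_out // subn0; move: iS; rewrite inE -leqNgt leqn0 => /eqP ->; rewrite mul0r.
Qed.

(** Distinct [k] of support [S] give distinct cells of one lattice split, and the remaining cells
    add nonnegative terms. *)
Lemma sum_mixed_difference_support f S :
  ((\sum_(k : point | box m k && (support k == S)) `|mixed_difference f k|)%:E
    <= vitali_variation (@face_restriction R d f S))%E.
Proof.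
apply: (@le_trans _ _
  (split_variation (@face_restriction R d f S) (@lattice_partition S))%:E); last first.
  by apply: ereal_sup_ubound; exists (@lattice_partition S) => // s; apply: lattice_partitionP.
rewrite lee_fin /split_variation.
have xp s : (0 < size (@lattice_partition S s))%N by rewrite size_lattice_partition.
(* The cell index is [k - 1]; for [k] in the box the default value of [insubd] is never taken. *)
pose l (k : point) : {dffun forall s : 'I_#|S|, 'I_(size (@lattice_partition S s))} :=
  finfun (fun s => insubd (Ordinal (xp s)) (k (enum_val s)).-1).
have lE k s : box m k -> l k s = (k (enum_val s)).-1 :> nat.
  move=> /forallP bk; rewrite ffunE val_insubd ifT // size_lattice_partition.
  by rewrite (leq_ltn_trans (leq_pred _) (bk _)).
have linj : {in [pred k | box m k && (support k == S)] &, injective l}.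
  move=> k k'; rewrite !inE => /andP[bk /eqP kS] /andP[bk' /eqP kS'] kk'.
  apply/ffunP => i; apply/val_inj => /=; case: (boolP (i \in S)) => iS.
    have : (k i).-1 = (k' i).-1.
      by rewrite -(enum_rankK_in iS iS) -!lE // kk'.
    have : (0 < k i)%N by move: iS; rewrite -kS inE.
    have : (0 < k' i)%N by move: iS; rewrite -kS' inE.
    by lia.
  have : (0 < k i)%N = false by apply/negbTE; move: iS; rewrite -{1}kS inE.
  have : (0 < k' i)%N = false by apply/negbTE; move: iS; rewrite -{1}kS' inE.
  by lia.
pose q (l0 : {dffun forall s : 'I_#|S|, 'I_(size (@lattice_partition S s))}) :=
  `|quasi_volume (@face_restriction R d f S)
      (partition_point (@lattice_partition S) (fun s => l0 s))
      (partition_point (@lattice_partition S) (fun s => (l0 s).+1))|.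
rewrite (eq_bigr (fun k => q (l k))).
  rewrite -(big_imset q linj) /= [leLHS]big_mkcond /=.
  by apply: ler_sum => l0 _; case: ifP => // _; rewrite normr_ge0.
move=> k /andP[bk /eqP kS]; rewrite /q (mixed_difference_quasi_volume f bk kS).
have kpos (s : 'I_#|S|) : (0 < k (enum_val s))%N.
  have : enum_val s \in support k by rewrite kS enum_valP.
  by rewrite inE.
have km s : (k (enum_val s) < m (enum_val s))%N by have /forallP := bk; apply.
congr `|quasi_volume _ _ _|; apply/rowP => s; rewrite !mxE.
  by rewrite nth_lattice_partition lE // ltnW // (leq_ltn_trans (leq_pred _)).
by rewrite nth_lattice_partition lE // prednK // ltnW.
Qed.

(** Grouping by support matches the sum over faces in the variation; [k = 0] corresponds to the
    empty face. *)
Lemma sum_mixed_difference_le f (V : R) : (hk0_variation f <= V%:E)%E ->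
  \sum_(k : point | box m k && [exists i, (0 < k i)%N]) `|mixed_difference f k| <= V.
Proof.
rewrite -lee_fin; apply: le_trans.
rewrite (partition_big support (fun S => S != finset.set0)) /=.
  rewrite -sumEFin; apply: lee_sum => S S0.
  apply: le_trans (sum_mixed_difference_support f S).
  rewrite lee_fin [leLHS]big_mkcond [leRHS]big_mkcond /=; apply: ler_sum => k _.
  by case: (box m k) => //=; case: ifP => [/andP[_ ->]//|_]; case: ifP.
move=> k /andP[_ /existsP[i ki]]; apply/set0Pn; exists i.
by rewrite inE.
Qed.

End HardyKrause.

(** * Gaussian noise *)

Section Density.
Local Open Scope ereal_scope.
Context d1 d2 (T1 : measurableType d1) (T2 : measurableType d2) (R : realType).
Variables (mu : {measure set T1 -> \bar R}) (nu : {measure set T2 -> \bar R}).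
Variables (phi : T1 -> T2) (h : T1 -> R).
Hypotheses (mphi : measurable_fun setT phi) (mh : measurable_fun setT h).
Hypothesis h0 : forall x, (0 <= h x)%R.
Hypothesis nuE : forall A, measurable A ->
  \int[mu]_x (h x * \1_A (phi x))%:E = nu A.

Import HBNNSimple.

(** Extension from indicators by simple functions and monotone convergence. It serves for the
    Lebesgue density of the normal law and for one noise coordinate weighted by a function of the
    others. *)
Lemma ge0_integral_density (g : T2 -> R) : measurable_fun setT g ->
  (forall y, (0 <= g y)%R) -> \int[mu]_x (h x * g (phi x))%:E = \int[nu]_y (g y)%:E.
Proof.
move=> mg g0.
have mg' : measurable_fun setT (EFin \o g) by apply/measurable_EFinP.
pose f_ := nnsfun_approx measurableT mg'.
have cvgf y : (f_ n y)%:E @[n --> \oo] --> (g y)%:E.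
  by apply: (@cvg_nnsfun_approx _ _ _ _ measurableT _ mg') => // ? _; rewrite lee_fin.
have ndf y m n : (m <= n)%N -> (f_ m y <= f_ n y)%R.
  by move=> mn; exact/lefP/nd_nnsfun_approx.
have mfphi n : measurable_fun setT (fun x => f_ n (phi x)).
  by apply: measurableT_comp.
transitivity (limn (fun n => \int[mu]_x (h x * f_ n (phi x))%:E)).
  rewrite -monotone_convergence//.
  - apply: eq_integral => x _; apply/esym/cvg_lim => //.
    exact: (@cvgeZl nat _ R (fun n => (f_ n (phi x))%:E) _ (h x)%:E isT (cvgf (phi x))).
  - by move=> n; apply/measurable_EFinP; apply: measurable_funM.
  - by move=> n x _; rewrite lee_fin mulr_ge0.
  - by move=> x _ m n mn; rewrite lee_fin ler_wpM2l// ndf.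
transitivity (limn (fun n => \int[nu]_y (f_ n y)%:E)); last first.
  rewrite -monotone_convergence//.
  - by apply: eq_integral => y _; apply/cvg_lim.
  - by move=> n; apply/measurable_EFinP.
  - by move=> n x _; rewrite lee_fin.
  - by move=> x _ m n mn; rewrite lee_fin ndf.
congr (limn _); apply/funext => n.
have m1 k : measurable_fun setT (fun x : T1 => \1_(f_ n @^-1` [set k]) (phi x) : R).
  by apply: measurableT_comp.
under [RHS]eq_integral do rewrite fimfunE -fsumEFin//.
rewrite [RHS]ge0_integral_fsum//; last 2 first.
- by move=> y; exact/measurable_EFinP/measurable_funM.
- by move=> y x _; rewrite nnfun_muleindic_ge0.
have k0 k x : (0 <= k * \1_(f_ n @^-1` [set k]) (phi x))%R.
  by rewrite -lee_fin EFinM nnfun_muleindic_ge0.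
under [LHS]eq_integral.
  move=> x _; rewrite fimfunE EFinM -fsumEFin// ge0_mule_fsumr; last first.
    by move=> k; rewrite lee_fin.
  under eq_fsbigr do rewrite -EFinM.
  over.
rewrite [LHS]ge0_integral_fsum//; last 2 first.
- move=> k; apply/measurable_EFinP; apply: measurable_funM => //.
  by apply: measurable_funM.
- by move=> k x _; rewrite lee_fin mulr_ge0.
apply: eq_fsbigr => k /[!inE] -[y _ <-].
have fy0 : (0 <= f_ n y)%R by [].
rewrite integralZl_indic_nnsfun// integral_indic// setIT -nuE//.
under eq_integral do rewrite mulrCA EFinM.
rewrite ge0_integralZl_EFin//.
  by move=> x _; rewrite lee_fin mulr_ge0.
by apply/measurable_EFinP; apply: measurable_funM.
Qed.

End Density.

Section Normal.
Variable R : realType.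
Local Notation mu := (@lebesgue_measure R).

(** Completing the square: the exponential tilt of the centred density is a multiple of the density
    of mean [a * s ^+ 2]. *)
Lemma normal_mgf (s : R) (a : R) : 0 < s ->
  (\int[normal_prob 0 s]_x (expR (a * x))%:E = (expR (a ^+ 2 * s ^+ 2 / 2))%:E)%E.
Proof.
move=> s0; have sN0 : s != 0 by rewrite gt_eqF.
have mexp : measurable_fun setT (fun x : R => expR (a * x)).
  by apply: measurableT_comp => //; apply: measurable_funM.
rewrite -(@ge0_integral_density _ _ _ _ _ mu (normal_prob 0 s) id (normal_pdf 0 s)) //.
- transitivity (\int[mu]_x ((expR (a ^+ 2 * s ^+ 2 / 2))%:E * (normal_pdf (a * s ^+ 2) s x)%:E))%E.
    apply: eq_integral => x _; rewrite -EFinM; congr (_%:E).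
    rewrite !normal_pdfE //= /normal_fun -[LHS]mulrA -expRD [RHS]mulrCA -expRD; congr (_ * expR _).
    by field.
  rewrite ge0_integralZl_EFin ?integral_normal_pdf ?mule1 ?expR_ge0 //.
  + by move=> x _; rewrite lee_fin normal_pdf_ge0.
  + by apply/measurable_EFinP; apply: measurable_normal_pdf.
- exact: measurable_normal_pdf.
- exact: normal_pdf_ge0.
- move=> A mA; rewrite /normal_prob [RHS]integral_mkcond; apply: eq_integral => x _.
  rewrite /patch indicE; case: ifP => _; rewrite ?mulr1 ?mulr0 //.
Qed.

End Normal.

(** * Exponential moments of linear combinations of the noise *)

Section GaussianVector.
Variables (R : realType) (n : nat).
Variables (disp : measure_display) (T : measurableType disp) (P : probability T R).
Variables (sigma : R) (X : 'I_n -> {RV P >-> R}).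
Hypotheses (sigma0 : 0 < sigma) (iidX : iid_normal sigma X).
Variable a : 'I_n -> R.

Let factor (k : nat) (A : 'I_n -> set R) (i : 'I_n) (x : R) : R :=
  if (i < k)%N then expR (a i * x) else \1_(A i) x.

Let factor_mean (k : nat) (A : 'I_n -> set R) (i : 'I_n) : R :=
  if (i < k)%N then expR (a i ^+ 2 * sigma ^+ 2 / 2)
  else fine (normal_prob 0 sigma (A i)).

Let factor_ge0 k A i x : 0 <= factor k A i x.
Proof. by rewrite /factor; case: ifP; rewrite ?expR_ge0. Qed.

Let factor_mean_ge0 k A i : 0 <= factor_mean k A i.
Proof. by rewrite /factor_mean; case: ifP; rewrite ?expR_ge0 ?fine_ge0. Qed.

Let measurable_factor k A i : (forall i, measurable (A i)) ->
  measurable_fun setT (factor k A i).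
Proof.
move=> mA; rewrite /factor; case: (i < k)%N; last first.
  exact: (measurable_indic (mA i)).
by apply: measurableT_comp => //; apply: measurable_funM.
Qed.

(* Independence turns from indicators to exponentials one coordinate at a time. *)
Let integral_prod_factor k A : (forall i, measurable (A i)) ->
  (\int[P]_w (\prod_i factor k A i (X i w))%:E = (\prod_i factor_mean k A i)%:E)%E.
Proof.
elim: k A => [|k IH] A mA.
  have [indep lawX] := iidX.
  have mS : measurable [set w | forall i, i \in [set: 'I_n]%SET -> A i (X i w)].
    rewrite (_ : [set _ | _] = \bigcap_(i in [set: 'I_n]) (X i @^-1` A i)).
      apply: fin_bigcap_measurable => // i _.
      by rewrite -[X in measurable X]setTI; apply: measurable_funP.
    by apply/seteqP; split => w /= H i *; apply: H; rewrite ?inE.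
  transitivity (\int[P]_w (\1_[set w | forall i, i \in [set: 'I_n]%SET -> A i (X i w)] w)%:E)%E.
    apply: eq_integral => w _; congr (_%:E); rewrite indicE.
    case: (boolP (w \in _)) => [/set_mem Aw|].
      by rewrite big1 // => i _; rewrite /factor /= indicE mem_set // ; apply: Aw; rewrite inE.
    move=> /negP wA; have [i Ai] : exists i, ~ A i (X i w).
      apply: contrapT => H; apply: wA; apply/mem_set => i _.
      by apply: contrapT => Ai; apply: H; exists i.
    by rewrite (bigD1 i) //= /factor indicE memNset // mul0r.
  rewrite integral_indic // setIT.
  transitivity (\prod_(i in [set: 'I_n]%SET) P (X i @^-1` A i))%E; first exact: indep.
  rewrite -prodEFin.
  apply: eq_big => [i|i _]; first by rewrite inE.
  rewrite /factor_mean /= fineK; first exact: (lawX i (A i) (mA i)).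
  by apply: fin_num_measure; apply: mA.
case: (ltnP k n) => kn; last first.
  transitivity (\int[P]_w (\prod_i factor k A i (X i w))%:E)%E.
    apply: eq_integral => w _; congr (_%:E); apply: eq_bigr => i _.
    by rewrite /factor !(leq_trans (ltn_ord i)) // ltnW.
  rewrite IH //; congr (_%:E); apply: eq_bigr => i _.
  by rewrite /factor_mean !(leq_trans (ltn_ord i)) // ltnW.
pose z := Ordinal kn.
have factorS B i x : i != z -> factor k.+1 B i x = factor k B i x.
  by move=> iz; rewrite /factor ltnS leq_eqVlt -[_ == k]/(i == z) (negPf iz).
have factor_meanS B i : i != z -> factor_mean k.+1 B i = factor_mean k B i.
  by move=> iz; rewrite /factor_mean ltnS leq_eqVlt -[_ == k]/(i == z) (negPf iz).
pose h w := \prod_(i | i != z) factor k A i (X i w).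
have h0 w : 0 <= h w by apply: prodr_ge0.
have mh : measurable_fun setT h.
  rewrite /h; under eq_fun do rewrite big_mkcond /=.
  apply: measurable_prod => i _; case: (i != z) => //.
  by apply: measurableT_comp => //; apply: measurable_factor.
pose c := \prod_(i | i != z) factor_mean k A i.
have c0 : 0 <= c by apply: prodr_ge0.
transitivity (\int[P]_w (h w * expR (a z * X z w))%:E)%E.
  apply: eq_integral => w _; congr (_%:E); rewrite (bigD1 z) //= mulrC; congr (_ * _).
    by apply: eq_bigr => i; apply: factorS.
  by rewrite /factor /= ltnSn.
have mX : measurable_fun [set: T] (X z) by apply: measurable_funP.
have mg : measurable_fun [set: R] (fun x => expR (a z * x)).
  by apply: measurableT_comp => //; apply: measurable_funM.
(* Independence in disguise: the induction hypothesis with [A z] replaced by [B] identifies the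
   weighted law of [X z] as [c] times the normal law. *)
have law B : measurable B ->
    (\int[P]_w (h w * \1_B (X z w))%:E = mscale (NngNum c0) (normal_prob 0 sigma) B)%E.
  move=> mB; pose A' i := if i == z then B else A i.
  have mA' i : measurable (A' i) by rewrite /A'; case: eqP.
  transitivity (\int[P]_w (\prod_i factor k A' i (X i w))%:E)%E.
    apply: eq_integral => w _; congr (_%:E); rewrite [RHS](bigD1 z) //= mulrC; congr (_ * _).
      by rewrite /factor /= ltnn /A' eqxx.
    by apply: eq_bigr => i /negPf iz; rewrite /factor /A' iz.
  rewrite IH // (bigD1 z) //= mulrC EFinM /mscale /=; congr (_%:E * _)%E.
    by apply: eq_bigr => i /negPf iz; rewrite /factor_mean /A' iz.
  rewrite /factor_mean /= ltnn /A' eqxx fineK //; apply: fin_num_measure; exact: mB.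
rewrite (ge0_integral_density (nu := mscale (NngNum c0) (normal_prob 0 sigma))
  mX mh h0 law mg); last by move=> y; rewrite expR_ge0.
have mgE : measurable_fun [set: R] (EFin \o (fun x => expR (a z * x))).
  by apply/measurable_EFinP.
have g0 x : [set: R] x -> (0 <= (expR (a z * x))%:E)%E by rewrite lee_fin expR_ge0.
rewrite (ge0_integral_mscale (normal_prob 0 sigma) measurableT (NngNum c0) mgE g0) /=.
rewrite normal_mgf // -EFinM (bigD1 z) //= mulrC; congr (_ * _)%:E.
  by rewrite /factor_mean /= ltnSn.
by apply: eq_bigr => i iz; rewrite factor_meanS.
Qed.

Lemma iid_normal_mgf :
  (\int[P]_w (expR (\sum_i a i * X i w))%:E =
   (expR (sigma ^+ 2 / 2 * \sum_i a i ^+ 2))%:E)%E.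
Proof.
transitivity (\int[P]_w (\prod_i factor n (fun=> setT) i (X i w))%:E)%E.
  apply: eq_integral => w _; rewrite expR_sum; congr (_%:E); apply: eq_bigr => i _.
  by rewrite /factor ltn_ord.
rewrite integral_prod_factor //; congr (_%:E); rewrite big_distrr expR_sum /=.
apply: eq_bigr => i _; rewrite /factor_mean ltn_ord; congr expR; ring.
Qed.

End GaussianVector.

(** * Second moments and maxima of Gaussian combinations *)

Section MeanBound.
Variables (R : realType) (disp : measure_display) (T : measurableType disp).
Variable P : probability T R.

Definition mean_le (f : T -> R) (b : R) : Prop :=
  [/\ measurable_fun setT f, forall w, 0 <= f w & (\int[P]_w (f w)%:E <= b%:E)%E].

Lemma mean_le_cst c : 0 <= c -> mean_le (fun=> c) c.
Proof. by move=> c0; split => //; rewrite integral_cst //= probability_setT mule1. Qed.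

Lemma mean_le_scale f b c : 0 <= c -> mean_le f b -> mean_le (fun w => c * f w) (c * b).
Proof.
move=> c0 [mf f0 fb]; split; first exact: measurable_funM.
  by move=> w; rewrite mulr_ge0.
under eq_integral do rewrite EFinM.
rewrite ge0_integralZl_EFin // ?EFinM ?lee_wpmul2l //; last by apply/measurable_EFinP.
by move=> w _; rewrite lee_fin.
Qed.

Lemma mean_le_add f g b c : mean_le f b -> mean_le g c -> mean_le (fun w => f w + g w) (b + c).
Proof.
move=> [mf f0 fb] [mg g0 gc]; split; first exact: measurable_funD.
  by move=> w; rewrite addr_ge0.
under eq_integral do rewrite EFinD.
rewrite ge0_integralD //.
- by rewrite EFinD leeD.
- by move=> w _; rewrite lee_fin.
- by apply/measurable_EFinP.
- by move=> w _; rewrite lee_fin.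
- by apply/measurable_EFinP.
Qed.

Lemma mean_le_sum (I : Type) (r : seq I) (f : I -> T -> R) (b : I -> R) :
  (forall i, mean_le (f i) (b i)) ->
  mean_le (fun w => \sum_(i <- r) f i w) (\sum_(i <- r) b i).
Proof.
move=> fb; elim: r => [|i r IH].
  by under eq_fun do rewrite big_nil; rewrite big_nil; apply: mean_le_cst.
by under eq_fun do rewrite big_cons; rewrite big_cons; apply: mean_le_add.
Qed.

Lemma mean_le_trans f b c : b <= c -> mean_le f b -> mean_le f c.
Proof. by move=> bc [mf f0 fb]; split => //; apply: le_trans fb _; rewrite lee_fin. Qed.

(* The loss of an arbitrary selection of minimizers may fail to be measurable,
   which rules out the library's monotonicity lemmas for the integral. *)
Lemma integral_le_mean (f g : T -> R) b : (forall w, 0 <= f w) ->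
  (forall w, f w <= g w) -> mean_le g b -> (\int[P]_w (f w)%:E <= b%:E)%E.
Proof.
move=> f0 fg [mg g0]; apply: le_trans.
rewrite !ge0_integralTE; try by move=> w; rewrite lee_fin.
apply: ereal_sup_le => _ [h hf <-]; exists h => // w /=.
by apply: le_trans (hf w) _; rewrite lee_fin.
Qed.

Variables (n : nat) (sigma : R) (X : 'I_n -> {RV P >-> R}).
Hypotheses (sigma0 : 0 < sigma) (iidX : iid_normal sigma X).

Let Y (a : 'I_n -> R) (w : T) : R := \sum_i a i * X i w.

Lemma mean_le_exp (a : 'I_n -> R) l (v : R) : \sum_i a i ^+ 2 <= v ->
  mean_le (fun w => expR (l * Y a w)) (expR (l ^+ 2 * sigma ^+ 2 * v / 2)).
Proof.
move=> av; split => [|w|].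
- apply: measurableT_comp => //; apply: measurable_funM => //.
  by apply: measurable_sum => i; apply: measurable_funM.
- exact: expR_ge0.
rewrite /Y; under eq_integral.
  move=> w _; rewrite big_distrr /=.
  under eq_bigr do rewrite mulrA.
  over.
rewrite /= (iid_normal_mgf sigma0 iidX (fun i => l * a i)) lee_fin ler_expR.
under eq_bigr do rewrite exprMn.
rewrite -big_distrr /=
  (_ : l ^+ 2 * sigma ^+ 2 * v / 2 = sigma ^+ 2 / 2 * (l ^+ 2 * v)); last by ring.
by rewrite ler_wpM2l ?divr_ge0 ?sqr_ge0 // ler_wpM2l ?sqr_ge0.
Qed.

(** For [0 <= x], [expR x] is the square of [expR (x / 2) >= 1 + x / 2]. Second moments thus follow
    from exponential ones. *)
Lemma sqr_le_exp (x : R) : x ^+ 2 <= 4 * (expR x + expR (- x)).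
Proof.
wlog x0 : x / 0 <= x => [H|].
  case: (leP 0 x) => [/H //|/ltW xn].
  by have := H (- x); rewrite sqrrN opprK addrC; apply; lra.
have e2 : expR x = expR (x / 2) ^+ 2 by rewrite expr2 -expRD; congr expR; lra.
have := expR_ge1Dx (x / 2); have := expR_ge0 (- x); rewrite e2 !expr2; nra.
Qed.

Lemma mean_le_sqr (a : 'I_n -> R) : exists2 g,
  mean_le g (8 * expR (1 / 2) * sigma ^+ 2 * \sum_i a i ^+ 2) &
  forall w, Y a w ^+ 2 <= g w.
Proof.
set v := \sum_i a i ^+ 2.
have v0 : 0 <= v by apply: sumr_ge0 => i _; apply: sqr_ge0.
case: (eqVneq v 0) => [vE|vN].
  exists (fun=> 0); first by rewrite vE mulr0; apply: mean_le_cst.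
  move=> w; rewrite (_ : Y a w = 0) ?expr0n // /Y big1 // => i _.
  have : a i ^+ 2 <= 0.
    by rewrite -vE /v (bigD1 i) //= lerDl sumr_ge0 // => j _; apply: sqr_ge0.
  by rewrite -[_ <= 0]andbT -(sqr_ge0 (a i)) -eq_le sqrf_eq0 => /eqP ->; rewrite mul0r.
have s0 : 0 < sigma * Num.sqrt v by rewrite mulr_gt0 // sqrtr_gt0 lt_neqAle eq_sym vN.
set t := sigma * Num.sqrt v in s0 *.
have t2 : t ^+ 2 = sigma ^+ 2 * v by rewrite exprMn sqr_sqrtr.
(* Division by [t], which is [sigma] times the norm of [a], normalizes both exponential means to at
   most [expR (1 / 2)]. *)
exists (fun w => 4 * t ^+ 2 * (expR (t^-1 * Y a w) + expR (- t^-1 * Y a w))); last first.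
  move=> w; have := sqr_le_exp (t^-1 * Y a w).
  rewrite exprMn exprVn ler_pdivrMl ?exprn_gt0 // mulNr; nra.
rewrite (_ : 8 * _ * _ * _ = 4 * t ^+ 2 * (expR (1 / 2) + expR (1 / 2))); last by rewrite t2; ring.
apply: mean_le_scale; first by rewrite mulr_ge0 ?sqr_ge0.
have E : t ^-2 * sigma ^+ 2 * v / 2 = 1 / 2.
  by rewrite -mulrA -mulrA (mulrA (sigma ^+ 2)) -t2 mulrA mulVf ?expf_neq0 ?gt_eqF.
have M x : x ^+ 2 = t ^-2 -> mean_le (fun w => expR (x * Y a w)) (expR (1 / 2)).
  by move=> xE; rewrite -E -xE; apply: mean_le_exp.
by apply: mean_le_add; apply: M; rewrite ?sqrrN exprVn.
Qed.

Lemma le_add_exp (t c : R) : t <= c + expR (t - c).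
Proof. by have := expR_ge1Dx (t - c); lra. Qed.

(** Smooth union bound: by [le_add_exp], each scaled variable is at most [c] plus [expR (- c)] times
    the sum of all exponentials. The scale [l] bounds every exponential mean by [expR (q / 2)]. *)
Lemma mean_le_max (K : finType) (a : K -> 'I_n -> R) (v : R) (s d : nat) :
  (0 < d)%N -> 0 < v -> (#|K| <= 2 ^ (s.+1 * d))%N ->
  (forall k, \sum_i a k i ^+ 2 <= v) ->
  exists2 g, mean_le g (4 * d%:R * sigma * Num.sqrt (s.+1%:R * v)) &
    forall w k, `|Y (a k) w| <= g w.
Proof.
move=> d0 v0 cK av.
set q : R := s.+1%:R; have q0 : 0 < q by rewrite ltr0n.
have d1 : 1 <= d%:R :> R by rewrite ler1n.
(* One part [d * q] covers the logarithm of [#|K|], and [2 * d * q] that of [2 * expR (q / 2)], so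
   the exponential term has mean at most 1. *)
pose c : R := 3 * d%:R * q; have c0 : 0 <= c by rewrite !mulr_ge0 // ltW.
have r0 : 0 < Num.sqrt (q * v) by rewrite sqrtr_gt0 mulr_gt0.
pose l := q / (sigma * Num.sqrt (q * v)).
have l0 : 0 < l by rewrite divr_gt0 // mulr_gt0.
have lE : l ^+ 2 * sigma ^+ 2 * v / 2 = q / 2.
  rewrite /l expr_div_n exprMn sqr_sqrtr ?mulr_ge0 ?ltW //.
  by field; rewrite !gt_eqF.
exists (fun w => l^-1 * (c + expR (- c) * \sum_k (expR (l * Y (a k) w) + expR (- l * Y (a k) w)))).
  apply: (@mean_le_trans _ (l^-1 * (c + expR (- c) * \sum_(k : K) (expR (q / 2) + expR (q / 2))))).
    have -> : 4 * d%:R * sigma * Num.sqrt (q * v) = l^-1 * (4 * d%:R * q).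
      by rewrite /l; field; rewrite !gt_eqF.
    rewrite ler_pM2l ?invr_gt0 // sumr_const.
    apply: (@le_trans _ _ (c + 1)); last first.
      have : 1 <= q by rewrite ler1n.
      by rewrite /c; nra.
    rewrite lerD2l expRN mulrC ler_pdivrMr ?expR_gt0 // mul1r.
    have e2 : 2 <= expR 1 :> R by have := expR_ge1Dx (1 : R).
    have h1 : #|K|%:R <= expR (d%:R * q).
      apply: (@le_trans _ _ (2 ^+ (s.+1 * d))); first by rewrite -natrX ler_nat.
      have -> : expR (d%:R * q) = expR 1 ^+ (s.+1 * d).
        by rewrite -expRM_natl natrM -/q mulr1 mulrC.
      by apply: lerXn2r; rewrite ?nnegrE ?expR_ge0.
    have h2 : 2 * expR (q / 2) <= expR (2 * d%:R * q).
      apply: (@le_trans _ _ (expR 1 * expR (q / 2))); first by rewrite ler_wpM2r ?expR_ge0.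
      rewrite -expRD ler_expR; have : 1 <= q by rewrite ler1n.
      nra.
    rewrite (_ : c = d%:R * q + 2 * d%:R * q); last by rewrite /c; ring.
    rewrite expRD -[_ *+ #|_|]mulr_natl; apply: ler_pM => //.
    by move: h2; rewrite mulr_natl mulr2n.
  apply: mean_le_scale; first by rewrite invr_ge0 ltW.
  apply: mean_le_add; first exact: mean_le_cst.
  apply: mean_le_scale; first exact: expR_ge0.
  apply: mean_le_sum => k; rewrite -lE; apply: mean_le_add; first exact: mean_le_exp.
  by rewrite -[l ^+ 2]sqrrN; apply: mean_le_exp.
move=> w k; rewrite ler_pdivlMl //.
have S : expR (- c) * (expR (l * Y (a k) w) + expR (- l * Y (a k) w)) <=
    expR (- c) * \sum_k (expR (l * Y (a k) w) + expR (- l * Y (a k) w)).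
  rewrite ler_wpM2l ?expR_ge0 // [leRHS](bigD1 k) //= lerDl.
  by apply: sumr_ge0 => j _; rewrite addr_ge0 ?expR_ge0.
apply: le_trans (lerD (lexx c) S); rewrite mulrDr -!expRD.
have p1 := le_add_exp (l * Y (a k) w) c; have p2 := le_add_exp (- l * Y (a k) w) c.
rewrite ![- c + _]addrC.
have e1 := expR_ge0 (l * Y (a k) w - c); have e2 := expR_ge0 (- l * Y (a k) w - c).
by move: p1 p2 e1 e2; case: (ger0P (Y (a k) w)) => _; lra.
Qed.

End MeanBound.

(** * Rates *)

Section RealEstimates.
Variable R : realType.

(** Of the two factors [Num.sqrt r], one pays for degree [d] by induction and the other for the
    extra linear factor by a Bernoulli inequality. *)
Lemma poly_le_geometric (d : nat) (r : R) : 1 < r ->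
  exists2 A : R, 0 < A & forall t : nat, t.+1%:R ^+ d <= A * r ^+ t.
Proof.
elim: d r => [|d IH] r r1.
  by exists 1 => // t; rewrite expr0 mul1r exprn_ege1 // ltW.
have s1 : 1 < Num.sqrt r by rewrite -[1]sqrtr1 ltr_sqrt // (lt_trans ltr01).
have r0 : 0 < r by apply: lt_trans r1.
have [A A0 HA] := IH _ s1.
pose e := Num.min 1 (Num.sqrt r - 1).
have e0 : 0 < e by rewrite lt_min ltr01 subr_gt0.
have bern t : e * t.+1%:R <= Num.sqrt r ^+ t.
  have e1 : e <= 1 by rewrite ge_min lexx.
  have er : e <= Num.sqrt r - 1 by rewrite ge_min lexx orbT.
  elim: t => [|t IHt]; first by rewrite expr0 mulr1.
  rewrite exprS -natr1; have : 1 <= Num.sqrt r ^+ t by rewrite exprn_ege1 // ltW.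
  move: IHt er; set q := Num.sqrt r ^+ t; set b := Num.sqrt r => IHt er q1.
  nra.
exists (A / e); first by rewrite divr_gt0.
move=> t; rewrite exprS -[r in r ^+ t](sqr_sqrtr (ltW r0)) expr2 exprMn.
rewrite (_ : A / e * _ = Num.sqrt r ^+ t / e * (A * Num.sqrt r ^+ t)); last by ring.
apply: ler_pM => //.
by rewrite ler_pdivlMr // mulrC.
Qed.

(** As [J + t + 1 <= (J + 1) * (t + 1)], the polynomial growth past [J] costs at most
    [A * (3 / 2) ^ t] against the decay [2 ^ t], which leaves a geometric series of ratio
    [Num.sqrt (3 / 4)]. *)
Lemma sum_sqrt_tail (d : nat) : exists2 C : R, 0 < C & forall J M : nat,
  \sum_(J.+1 <= s < M) Num.sqrt (s.+1%:R ^+ d / 2 ^+ s) <=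
    C * Num.sqrt (J.+1%:R ^+ d / 2 ^+ J).
Proof.
have r1 : (1 : R) < 3 / 2 by lra.
have [A A0 HA] := poly_le_geometric d r1.
pose q : R := Num.sqrt (3 / 4).
have q0 : 0 < q by rewrite sqrtr_gt0; lra.
have q1 : q < 1 by rewrite -[1]sqrtr1 ltr_sqrt; lra.
exists (Num.sqrt A / (1 - q)); first by rewrite divr_gt0 ?sqrtr_gt0 // subr_gt0.
move=> J M; set Z := Num.sqrt (J.+1%:R ^+ d / 2 ^+ J).
have Z0 : 0 <= Z by apply: sqrtr_ge0.
have sqX t : q ^+ t = Num.sqrt ((3 / 4) ^+ t).
  by elim: t => [|t IH]; rewrite ?expr0 ?sqrtr1 // !exprS sqrtrM ?IH // divr_ge0.
have term s : (J <= s)%N -> Num.sqrt (s.+1%:R ^+ d / 2 ^+ s) <= Z * Num.sqrt A * q ^+ (s - J).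
  move=> Js; rewrite -{1 2}(subnKC Js); set t := (s - J)%N.
  rewrite sqX.
  have P1 : 0 <= J.+1%:R ^+ d / 2 ^+ J :> R by rewrite divr_ge0 ?exprn_ge0.
  have P2 : 0 <= J.+1%:R ^+ d / 2 ^+ J * A by rewrite mulr_ge0 // ltW.
  rewrite /Z -(sqrtrM _ P1) -(sqrtrM _ P2) ler_wsqrtr //.
  have h1 : (J + t).+1%:R ^+ d <= J.+1%:R ^+ d * t.+1%:R ^+ d :> R.
    rewrite -exprMn lerXn2r ?nnegrE ?mulr_ge0 // -natrM ler_nat; nia.
  have -> : J.+1%:R ^+ d / 2 ^+ J * A * (3 / 4) ^+ t =
      J.+1%:R ^+ d * (A * (3 / 2) ^+ t) / 2 ^+ (J + t) :> R.
    rewrite exprD !expr_div_n (_ : 4 = 2 * 2 :> R); last by lra.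
    by rewrite exprMn; field; rewrite !expf_neq0 ?pnatr_eq0.
  rewrite ler_pM2r ?invr_gt0 ?exprn_gt0 //; apply: le_trans h1 _.
  by rewrite ler_wpM2l ?exprn_ge0.
apply: (@le_trans _ _ (\sum_(J <= s < M) Z * Num.sqrt A * q ^+ (s - J))).
  case: (leqP M J) => MJ; first by rewrite !big_geq // leqW.
  rewrite [leRHS]big_ltn // subnn -[leLHS]add0r lerD //.
    by rewrite !mulr_ge0 ?sqrtr_ge0 // ltW.
  by rewrite !big_nat; apply: ler_sum => s /andP[/ltnW Js _]; apply: term.
rewrite -big_distrr /= (_ : Num.sqrt A / (1 - q) * Z = Z * Num.sqrt A * (1 - q)^-1); last by ring.
rewrite ler_wpM2l ?mulr_ge0 ?sqrtr_ge0 // -{1}[J]add0n big_addn.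
under eq_bigr do rewrite addnK.
rewrite big_mkord -[leRHS]mul1r ler_pdivlMr ?subr_gt0 //.
rewrite mulrC -opprB mulNr -subrX1 opprB.
by rewrite gerBl exprn_ge0 // ltW.
Qed.

Lemma ln2_ge_half : 1 / 2 <= ln 2 :> R.
Proof.
have h : ln (1 + - (1 / 2)) <= - (1 / 2) :> R by apply: le_ln1Dx; lra.
move: h; rewrite (_ : 1 + - (1 / 2) = 2^-1 :> R); last by lra.
by rewrite lnV ?posrE //; lra.
Qed.

Lemma ln_le_self (x : R) : 0 < x -> ln x <= x.
Proof.
move=> x0; have := @le_ln1Dx R (x - 1); rewrite (_ : 1 + (x - 1) = x); last by ring.
by move=> h; apply: le_trans (h _) _; lra.
Qed.

(* The two terms balance when [2 ^ J] is the largest power of two at most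
   [max 1 (T ^ (2/3) * ln (2 + T) ^ ((2 - d) / 3))]. *)
Lemma truncation_level (d : nat) : (0 < d)%N ->
  exists2 C : R, 0 < C & forall T : R, 0 < T -> exists J : nat,
    J.+1%:R ^+ d.-1 * 2 ^+ J + T * Num.sqrt (J.+1%:R ^+ d / 2 ^+ J) <=
      C * (T `^ (2 / 3) * ln (2 + T) `^ ((2 * d%:R - 1) / 3) + 1).
Proof.
(* Large enough for [J.+1 <= c * l], given [u <= l], [-1 <= v <= l] and [1 / 2 <= l]. *)
move=> d0; pose c : R := 6 + 4 * d%:R.
have c0 : 0 < c by rewrite ltr_wpDr // mulr_ge0.
exists (c ^+ d.-1 + 1 + Num.sqrt (2 * c ^+ d)).
  by rewrite !addr_gt0 ?sqrtr_gt0 ?mulr_gt0 ?exprn_gt0.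
move=> T T0; set l := ln (2 + T).
have l2 : 1 / 2 <= l by apply: le_trans ln2_ge_half _; rewrite ler_ln ?posrE; lra.
have l0 : 0 < l by lra.
pose u := ln T; pose v := ln l.
have uE : T = expR u by rewrite lnK.
have vE : l = expR v by rewrite lnK.
have ul : u <= l by rewrite ler_ln ?posrE; lra.
have vl : v <= l by apply: ln_le_self.
have v1 : - v <= 1.
  have l2' : l^-1 <= 2 by rewrite -[l^-1]mul1r ler_pdivrMr //; lra.
  have il0 : 0 < l^-1 by rewrite invr_gt0.
  have := @le_ln1Dx R (l^-1 - 1); rewrite (_ : 1 + (l^-1 - 1) = l^-1); last by ring.
  by rewrite lnV ?posrE // -/v => h; apply: le_trans (h _) _; lra.
(* The balancing value of [2 ^ J]; exponents in [u] and [v] make the power identities below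
   linear. *)
pose B := expR (2 / 3 * u + (2 - d%:R) / 3 * v).
have B0 : 0 < B by apply: expR_gt0.
have Mx : exists k, (Num.max 1 B < 2 ^+ k.+1)%R.
  by exists (Num.Def.archi_bound (Num.max 1 B)); apply: upper_nthrootP.
(* For positive [J], minimality gives [2 ^ J <= max 1 B], and [2 ^ J > 1] excludes the bound by 1.
   The case [J = 0] is paid for by the [+ 1]. *)
have [J [JB Jmin]] : exists J, Num.max 1 B < 2 ^+ J.+1 /\ (J = 0%N \/ 2 ^+ J <= B).
  case: (ex_minnP Mx) => j jB jmin; exists j; split => //.
  case: j jB jmin => [|j] jB jmin; [by left|right].
  have : ~~ (Num.max 1 B < 2 ^+ j.+1) by apply/negP => /jmin; rewrite ltnn.
  rewrite -leNgt le_max => /orP[|//].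
  by rewrite leNgt exprn_egt1 // ltr1n.
exists J.
have D0 : 0 <= d%:R :> R by [].
have Dl : 0 <= d%:R * (l - 1 / 2) by rewrite mulr_ge0 // subr_ge0.
have Dv : 0 <= d%:R * (1 + v) by rewrite mulr_ge0 //; lra.
have Jl : J.+1%:R <= c * l.
  case: Jmin => [->|JB']; first by rewrite /c; lra.
  have : J%:R * ln 2 <= 2 / 3 * u + (2 - d%:R) / 3 * v.
    by rewrite -ler_expR mulrC expRM_natr lnK ?posrE.
  have : J%:R * (1 / 2) <= J%:R * ln 2 :> R by rewrite ler_wpM2l // ln2_ge_half.
  rewrite -[J.+1%:R]natr1 /c; lra.
have powE p : T `^ (2 / 3) * l `^ p = expR (2 / 3 * u + p * v).
  by rewrite /powR !gt_eqF // -expRD.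
rewrite powE; set Z := expR (2 / 3 * u + _).
have Z0 : 0 < Z by apply: expR_gt0.
have dE : d%:R = d.-1%:R + 1 :> R by rewrite natr1 prednK.
have t1 : J.+1%:R ^+ d.-1 * 2 ^+ J <= c ^+ d.-1 * Z + 1.
  case: Jmin => [->|JB']; first by rewrite expr1n mul1r expr0 lerDr mulr_ge0 ?exprn_ge0 // ltW.
  apply: (@le_trans _ _ (c ^+ d.-1 * Z)); last by rewrite lerDl.
  have -> : c ^+ d.-1 * Z = (c * l) ^+ d.-1 * B.
    rewrite exprMn -mulrA; congr (_ * _); rewrite vE -expRM_natl -expRD.
    by congr expR; rewrite dE; field.
  by apply: ler_pM; rewrite ?exprn_ge0 // lerXn2r ?nnegrE // mulr_ge0 ?ltW.
have t2 : T * Num.sqrt (J.+1%:R ^+ d / 2 ^+ J) <= Num.sqrt (2 * c ^+ d) * Z.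
  have -> : Num.sqrt (2 * c ^+ d) * Z = T * Num.sqrt (2 * c ^+ d * (Z / T) ^+ 2).
    have Pc : 0 <= 2 * c ^+ d by rewrite mulr_ge0 // exprn_ge0 // ltW.
    rewrite (sqrtrM _ Pc) sqrtr_sqr ger0_norm ?divr_ge0 ?(ltW Z0) ?(ltW T0) //.
    by field; rewrite gt_eqF.
  rewrite ler_wpM2l ?(ltW T0) // ler_wsqrtr //.
  have -> : 2 * c ^+ d * (Z / T) ^+ 2 = (c * l) ^+ d * (2 / B).
    have -> : (Z / T) ^+ 2 = l ^+ d / B.
      rewrite [in LHS]uE vE -!expRN -expRD -!expRM_natl -expRD.
      by congr expR; rewrite dE; field.
    by rewrite exprMn; ring.
  apply: ler_pM; rewrite ?exprn_ge0 ?invr_ge0 ?exprn_ge0 //.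
    by rewrite lerXn2r ?nnegrE // mulr_ge0 ?ltW.
  rewrite ler_pdivlMr // mulrC ler_pdivrMr ?exprn_gt0 // -exprS.
  by apply: ltW; apply: le_lt_trans JB; rewrite le_max lexx orbT.
have : 0 <= c ^+ d.-1 by rewrite exprn_ge0 // ltW.
have : 0 <= Num.sqrt (2 * c ^+ d) by apply: sqrtr_ge0.
move: t1 t2; lra.
Qed.

End RealEstimates.

(** Both sides are nonnegative and have the same cube. *)
Lemma rate_identity (R : realType) (s V n : R) : 0 < s -> 0 < V -> 0 < n ->
  s ^+ 2 / n * (V * Num.sqrt n / s) `^ (2 / 3) = (s ^+ 2 * V / n) `^ (2 / 3).
Proof.
move=> s0 V0 n0.
have cube (x : R) : 0 < x -> (x `^ (2 / 3)) ^+ 3 = x ^+ 2.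
  move=> x0; rewrite /powR gt_eqF // -expRM_natl -[x in RHS]lnK ?posrE // -expRM_natl.
  by congr expR; field.
have q0 : 0 < Num.sqrt n by rewrite sqrtr_gt0.
have T0 : 0 < V * Num.sqrt n / s by rewrite divr_gt0 // mulr_gt0.
have Y0 : 0 < s ^+ 2 * V / n by rewrite divr_gt0 // mulr_gt0 // exprn_gt0.
apply: (@pexpIrn _ 3) => //.
- by rewrite nnegrE mulr_ge0 ?powR_ge0 // divr_ge0 ?sqr_ge0 // ltW.
- by rewrite nnegrE powR_ge0.
rewrite exprMn !cube // [LHS](_ : _ = s ^+ 4 * V ^+ 2 * Num.sqrt n ^+ 2 / n ^+ 3).
  by rewrite (sqr_sqrtr (ltW n0)); field; rewrite gt_eqF.
by field; rewrite !gt_eqF.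
Qed.

Lemma dyadic_cover (m : nat) : (0 < m)%N -> {L | (m <= 2 ^ L <= 2 * m)%N}.
Proof.
move=> m0; exists (up_log 2 m); rewrite up_logP //=.
case: (ltnP 1 m) => m1; last by rewrite (_ : m = 1)%N ?up_log1 //; lia.
have /andP[h _] := up_log_bounds (ltnSn 1) m1.
have : (0 < up_log 2 m)%N by rewrite up_log_gt0.
by case: (up_log 2 m) h => // l; rewrite expnS /=; lia.
Qed.

(** * Integer coordinates for the enumerated design *)

Section LatticeReindex.
Variables (R : realType) (d n N : nat) (m : 'I_d -> nat).
Hypotheses (m0 : forall j, (0 < m j)%N) (mN : forall j, (m j <= N)%N).
Variable x : 'I_n -> 'rV[R]_d.
Hypothesis x_enum : set_bij [set: 'I_n] (@lattice_design R d m) x.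

Local Notation point := {ffun 'I_d -> 'I_N}.

Lemma lattice_point_inj (g h : point) :
  lattice_point R m (fun j => g j) = lattice_point R m (fun j => h j) -> g = h.
Proof.
move=> /rowP gh; apply/ffunP => j; apply/val_inj; move: (gh j); rewrite !mxE.
have mj : ((m j)%:R : R) != 0 by rewrite pnatr_eq0 -lt0n.
by move=> /(mulIf (invr_neq0 mj))/eqP; rewrite eqr_nat => /eqP.
Qed.

Lemma lattice_index : exists2 gam : 'I_n -> point, injective gam &
  (forall i, x i = lattice_point R m (fun j => gam i j)) /\
  (forall F : point -> R, \sum_(g | box m g) F g = \sum_i F (gam i)).
Proof.
have [xfun xinj xsurj] := x_enum.
have /choice[gam gamP] : forall i, exists g : point,
    box m g /\ x i = lattice_point R m (fun j => g j).
  move=> i; have [idx [idxm ->]] := xfun i I.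
  have idxN j : (idx j < N)%N by apply: leq_trans (mN j).
  exists [ffun j => Ordinal (idxN j)]; split.
    by apply/forallP => j; rewrite ffunE; apply: idxm.
  by apply/rowP => j; rewrite !mxE ffunE.
have gam_inj : injective gam.
  move=> i i' ii'; apply: xinj; rewrite ?inE //.
  by rewrite (gamP i).2 (gamP i').2 ii'.
exists gam => //; split=> [i|F]; first exact: (gamP i).2.
rewrite -(big_imset _ (in2W gam_inj)) /=; apply: eq_bigl => g.
apply/idP/imsetP => [bg|[i _ ->]]; last exact: (gamP i).1.
have /xsurj[i _ xi] : lattice_design m (lattice_point R m (fun j => g j)).
  by exists (fun j => g j); split => // j; have /forallP := bg; apply.
exists i => //; apply: lattice_point_inj; rewrite -xi; exact: (gamP i).2.
Qed.

End LatticeReindex.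

(** * Assembly of the risk bound from the noise estimates and the truncation level *)

Theorem theorem4p5 (R : realType) (d : nat) (d_ge1 : (1 <= d)%N) :
  exists C : R,
  forall (m : 'I_d -> nat) (m_ge1 : forall j, (1 <= m j)%N)
    (n : nat) (n_def : n = (\prod_(j < d) m j)%N)
    (x : 'I_n -> 'rV[R]_d)
    (x_enum : set_bij [set: 'I_n] (@lattice_design R d m) x)
    (sigma : R) (sigma_gt0 : 0 < sigma)
    (fstar : 'rV[R]_d -> R)
    (disp : measure_display) (T : measurableType disp) (P : probability T R)
    (xi : 'I_n -> {RV P >-> R}) (xi_iid : iid_normal sigma xi)
    (V : R) (V_gt0 : 0 < V) (V_ge : (hk0_variation fstar <= V%:E)%E)
    (fhat : T -> 'rV[R]_d -> R)
    (fhat_lse : forall w : T,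
       is_hk0_lse x (fun i => fstar (x i) + xi i w) V (fhat w)),
  (risk x P fhat fstar <=
    (C * (sigma ^+ 2 * V / n%:R) `^ (2 / 3)
       * (ln (2 + V * Num.sqrt n%:R / sigma)) `^ ((2 * d%:R - 1) / 3)
     + C * (sigma ^+ 2 / n%:R))%:E)%E.
Proof.
have [C1 C1_gt0 truncation] := truncation_level R d_ge1.
have [C2 C2_gt0 tail] := sum_sqrt_tail R d.
pose eh : R := expR (1 / 2).
(* The 64 collects 4 from the basic inequality, 8 from the second moments and 2 from [2 ^ J.+1]; the
   32 collects 8 from [4 * (2 * V)] and 4 from the maximal bound. *)
pose C0 : R := 64 * eh + 32 * d%:R * 2 ^+ d * C2.
exists (C0 * C1) => m m_ge1 n n_def x x_enum sigma sigma_gt0 fstar disp T P xi xi_iid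
  V V_gt0 V_ge fhat fhat_lse.
have n_gt0 : (0 < n)%N by rewrite n_def prodn_gt0.
have nR : 0 < n%:R :> R by rewrite ltr0n.
pose N := (\max_j m j)%N.
have mN j : (m j <= N)%N by apply: leq_bigmax.
pose L j := sval (dyadic_cover (m_ge1 j)).
have mL j : (m j <= 2 ^ L j)%N by rewrite /L; case: dyadic_cover => l /= /andP[].
have Lm j : (2 ^ L j <= 2 * m j)%N by rewrite /L; case: dyadic_cover => l /= /andP[].
pose K := (\max_j L j).+1.
have LK j : (L j < K)%N by rewrite ltnS leq_bigmax.
have [gam gam_inj [xE sum_box]] := lattice_index m_ge1 mN x_enum.
set Tn := V * Num.sqrt n%:R / sigma.
have Tn_gt0 : 0 < Tn by rewrite divr_gt0 // mulr_gt0 // sqrtr_gt0.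
have [J JP] := truncation Tn Tn_gt0.
(* The noise carried to the grid: at most one summand, as [gam] is injective, and 0 off the
   design. *)
pose Z w (g : {ffun 'I_d -> 'I_N}) : R := \sum_(i | gam i == g) xi i w.
have ZE w (F : {ffun 'I_d -> 'I_N} -> R) : \sum_g Z w g * F g = \sum_i F (gam i) * xi i w.
  rewrite (partition_big gam predT) //=; apply: eq_bigr => g _.
  by rewrite big_distrl; apply: eq_bigr => i /eqP ->; rewrite mulrC.
have sq_le (F : {ffun 'I_d -> 'I_N} -> R) : \sum_i F (gam i) ^+ 2 <= \sum_g F g ^+ 2.
  rewrite -(sum_box (fun g => F g ^+ 2)) [leLHS]big_mkcond.
  by apply: ler_sum => g _; case: ifP => // _; apply: sqr_ge0.
pose low h i := low_proj R K m L J (gam i) h.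
have /choice[G GP] : forall h, exists g : T -> R,
    mean_le P g (8 * eh * sigma ^+ 2 * \sum_i low h i ^+ 2) /\
    forall w, (\sum_i low h i * xi i w) ^+ 2 <= g w.
  by move=> h; have [g ? ?] := mean_le_sqr sigma_gt0 xi_iid (low h); exists g.
pose v s : R := s.+1%:R ^+ d.-1 * (4 ^+ d * n%:R / 2 ^+ s).
pose high s k i := level_step R K m L s (@corner d L s k) (gam i).
have /choice[B BP] : forall s : nat, exists g : T -> R,
    mean_le P g (4 * d%:R * sigma * Num.sqrt (s.+1%:R * v s)) /\
    forall w k, `|\sum_i high s k i * xi i w| <= g w.
  move=> s.
  have v0 : 0 < v s by rewrite mulr_gt0 ?exprn_gt0 // divr_gt0 ?mulr_gt0 ?exprn_gt0.
  have cK : (#|{ffun 'I_d -> 'I_(2 ^ s).+1}| <= 2 ^ (s.+1 * d))%N.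
    rewrite card_ffun !card_ord expnM leq_exp2r // expnS mul2n -addnn.
    by rewrite -addn1 leq_add2l expn_gt0.
  have hv k : \sum_i high s k i ^+ 2 <= v s.
    by apply: le_trans (sq_le _) _; rewrite /v n_def; apply: level_step_norm.
  by have [g ? ?] := mean_le_max sigma_gt0 xi_iid d_ge1 v0 cK hv; exists g.
have pointwise w : loss x (fhat w) fstar <=
    n%:R^-1 * (4 * (\sum_h G h w) + 8 * V * \sum_(J.+1 <= s < (d * K).+1) B s w).
  have [fhatV fhat_min] := fhat_lse w.
  pose D (g : {ffun 'I_d -> 'I_N}) :=
    fhat w (lattice_point R m (fun j => g j)) - fstar (lattice_point R m (fun j => g j)).
  pose beta (k : {ffun 'I_d -> 'I_N}) :=
    mixed_difference m (fhat w) k - mixed_difference m fstar k.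
  rewrite /loss ler_pM2l ?invr_gt0 //.
  have -> : \sum_i (fhat w (x i) - fstar (x i)) ^+ 2 = \sum_(g | box m g) D g ^+ 2.
    by rewrite sum_box; apply: eq_bigr => i _; rewrite /D -xE.
  have DE g : box m g -> D g = \sum_(k | box m k) beta k * orthant R (fun j => k j) g.
    move=> bg; rewrite /D !(mixed_difference_expansion _ bg) -sumrB.
    by apply: eq_bigr => k _; rewrite mulrBl.
  (* The estimator and [fstar] both have variation at most [V]. *)
  have betaV : \sum_(k | box m k && [exists j, (0 < k j)%N]) `|beta k| <= 2 * V.
    apply: (@le_trans _ _ (\sum_(k : {ffun 'I_d -> 'I_N} | box m k && [exists j, (0 < k j)%N])
        (`|mixed_difference m (fhat w) k| + `|mixed_difference m fstar k|))).
      by apply: ler_sum => k _; apply: ler_normB.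
    rewrite big_split mulr_natl mulr2n.
    by apply: lerD; apply: sum_mixed_difference_le.
  have noise s k : (J < s)%N ->
      `|\sum_g Z w g * level_step R K m L s (@corner d L s k) g| <= B s w.
    by move=> _; rewrite ZE; apply: (BP s).2.
  (* Optimality against the competitor [fstar], feasible by [V_ge]; the pure noise squares
     cancel. *)
  have basic : \sum_(g | box m g) D g ^+ 2 <= 2 * \sum_(g | box m g) Z w g * D g.
    rewrite !sum_box.
    have Zgam i : Z w (gam i) = xi i w.
      by rewrite /Z (big_pred1 i) // => i'; rewrite /= (inj_eq gam_inj).
    have := fhat_min _ V_ge; rewrite /residual ler_pM2l ?invr_gt0 // -subr_ge0 -sumrB => h.
    rewrite -subr_ge0 big_distrr -sumrB /=; move: h; congr (0 <= _).
    by apply: eq_bigr => i _; rewrite Zgam /D -xE; ring.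
  apply: le_trans (basic_inequality d_ge1 mN mL LK DE betaV noise basic) _.
  rewrite (_ : 4 * (2 * V) = 8 * V); last by ring.
  rewrite lerD2r ler_pM2l //; apply: ler_sum => h _.
  by rewrite /low_noise ZE; apply: (GP h).2.
have mean : mean_le P
    (fun w => n%:R^-1 * (4 * (\sum_h G h w) + 8 * V * \sum_(J.+1 <= s < (d * K).+1) B s w))
    (n%:R^-1 * (4 * (\sum_h 8 * eh * sigma ^+ 2 * \sum_i low h i ^+ 2) +
       8 * V * \sum_(J.+1 <= s < (d * K).+1) 4 * d%:R * sigma * Num.sqrt (s.+1%:R * v s))).
  apply: mean_le_scale; first by rewrite invr_ge0.
  apply: mean_le_add; apply: mean_le_scale.
  - by [].
  - by apply: mean_le_sum => h; apply: (GP h).1.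
  - by rewrite mulr_ge0 // ltW.
  - by apply: mean_le_sum => s; apply: (BP s).1.
rewrite /risk unlock; apply: (integral_le_mean _ pointwise).
  by move=> w; rewrite /loss mulr_ge0 ?invr_ge0 // sumr_ge0 // => i _; apply: sqr_ge0.
apply: mean_le_trans mean.
(* The squared Hilbert-Schmidt norm of an orthogonal projection is its trace. *)
have low_bound : \sum_h \sum_i low h i ^+ 2 <= J.+1%:R ^+ d.-1 * 2 ^+ J.+1.
  apply: le_trans (low_proj_trace R K d_ge1 mN mL J); apply: ler_sum => h _.
  apply: le_trans (sq_le (fun g => low_proj R K m L J g h)) _.
  rewrite (low_proj_diag R K L mN) le_eqVlt; apply/orP; left; apply/eqP.
  apply: eq_bigr => g _; congr (_ ^+ 2); apply: eq_bigr => j _.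
  exact: tensor_proj_sym.
(* The factor [s + 1] from the maximum raises the power [d - 1] to [d], and [4 ^ d] leaves the root
   as [2 ^ d]. *)
have high_bound : \sum_(J.+1 <= s < (d * K).+1) Num.sqrt (s.+1%:R * v s) <=
    2 ^+ d * Num.sqrt n%:R * (C2 * Num.sqrt (J.+1%:R ^+ d / 2 ^+ J)).
  have E s : Num.sqrt (s.+1%:R * v s) =
      2 ^+ d * Num.sqrt n%:R * Num.sqrt (s.+1%:R ^+ d / 2 ^+ s).
    have two0 : 0 <= 2 ^+ d :> R by rewrite exprn_ge0.
    rewrite -[2 ^+ d]ger0_norm // -sqrtr_sqr -!sqrtrM ?mulr_ge0 ?sqr_ge0 //.
    congr Num.sqrt; rewrite /v -[in s.+1%:R ^+ d](prednK d_ge1) [_ ^+ d.-1.+1]exprS.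
    have -> : 4 ^+ d = (2 ^+ d) ^+ 2 :> R by rewrite -exprM mulnC exprM; congr (_ ^+ _); ring.
    by set p2 := 2 ^+ d; set ps := 2 ^+ s; ring.
  under eq_bigr do rewrite E.
  by rewrite -big_distrr ler_wpM2l ?mulr_ge0 ?exprn_ge0 ?sqrtr_ge0 //; apply: tail.
rewrite -!big_distrr /=.
set SL := \sum_h _ in low_bound *; set SH := \sum_(_ <= _ < _) _ in high_bound *.
rewrite -rate_identity // -/Tn; set rate := _ `^ _ in JP *; set lg := _ `^ _ in JP *.
have -> : C0 * C1 * (sigma ^+ 2 / n%:R * rate) * lg + C0 * C1 * (sigma ^+ 2 / n%:R) =
    n%:R^-1 * (sigma ^+ 2 * (C0 * (C1 * (rate * lg + 1)))) by ring.
rewrite ler_pM2l ?invr_gt0 //.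
move: JP low_bound high_bound; rewrite exprS mulrCA.
set a := J.+1%:R ^+ d.-1 * 2 ^+ J; set q := Num.sqrt (_ / _) => JP low_bound high_bound.
have VT : V * Num.sqrt n%:R * sigma = sigma ^+ 2 * Tn by rewrite /Tn; field; rewrite gt_eqF.
have eh0 : 0 <= eh := expR_ge0 _.
have a0 : 0 <= a by rewrite mulr_ge0 ?exprn_ge0.
have b0 : 0 <= Tn * q by rewrite mulr_ge0 ?sqrtr_ge0 // ltW.
have p0 : 0 <= 32 * d%:R * 2 ^+ d * C2 by rewrite !mulr_ge0 ?exprn_ge0 // ltW.
have s20 : 0 <= sigma ^+ 2 := sqr_ge0 _.
have low_term : 4 * (8 * eh * sigma ^+ 2 * SL) <= sigma ^+ 2 * (64 * eh * a).
  rewrite (_ : sigma ^+ 2 * _ = 4 * (8 * eh * sigma ^+ 2 * (2 * a))); last by ring.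
  by rewrite ler_pM2l // ler_wpM2l // mulr_ge0 // mulr_ge0.
have high_term : 8 * V * (4 * d%:R * sigma * SH) <=
    sigma ^+ 2 * (32 * d%:R * 2 ^+ d * C2 * (Tn * q)).
  have -> : sigma ^+ 2 * (32 * d%:R * 2 ^+ d * C2 * (Tn * q)) =
      8 * V * (4 * d%:R * sigma * (2 ^+ d * Num.sqrt n%:R * (C2 * q))).
    transitivity (32 * d%:R * 2 ^+ d * C2 * q * (sigma ^+ 2 * Tn)); first by ring.
    by rewrite -VT; ring.
  by rewrite ler_pM2l ?mulr_gt0 // ler_wpM2l // !mulr_ge0 // ltW.
apply: le_trans (lerD low_term high_term) _; rewrite -mulrDr ler_wpM2l //.
apply: (@le_trans _ _ (C0 * (a + Tn * q))); last first.
  by rewrite ler_wpM2l // addr_ge0 // mulr_ge0.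
(* The slack consists of the two cross products. *)
rewrite -subr_ge0 (_ : _ - _ = 64 * eh * (Tn * q) + 32 * d%:R * 2 ^+ d * C2 * a).
  by rewrite addr_ge0 // mulr_ge0 // mulr_ge0.
by rewrite /C0; ring.
Qed.
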